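(* Almost all Latin squares, Steiner triple systems, or edge-parallelisms of complete graphs have no non-trivial automorphisms. Precisely, each of the following three statements holds. (1) For an integer $n\ge1$, let $L_n$ be the set of Latin squares of order $n$ with rows, columns and symbols indexed by fixed $n$-sets, and let $L_n^*\subseteq L_n$ be the set of those admitting a non-identity automorphism. Then $|L_n^*|/|L_n|\to0$ as $n\to\infty$. (2) For admissible $n$ (i.e. $n\equiv1$ or $3\pmod 6$), let $T_n$ be the set of Steiner triple systems on a fixed $n$-element point set and $T_n^*\subseteq T_n$ those admitting a non-identity automorphism. Then $|T_n^*|/|T_n|\to0$ as $n\to\infty$ through admissible values. (3) For admissible $n$ (i.e. $n$ even), let $P_n$ be the set of edge-parallelisms of the complete graph on a fixed $n$-element set and $P_n^*\subseteq P_n$ those admitting a non-identity automorphism. Then $|P_n^*|/|P_n|\to0$ as $n\to\infty$ through even values.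
   Context: A Latin square of order $n$ is an $n\times n$ array in which each of $n$ symbols occurs exactly once in each row and each column. Index the rows by $R=\{r_1,\dots,r_n\}$, columns by $C=\{c_1,\dots,c_n\}$ and symbols by $E=\{e_1,\dots,e_n\}$ (three disjoint sets); a cell is a triple $(r_i,c_j,e_k)$ such that the $(i,j)$ entry of the square is $e_k$. An automorphism of a Latin square is (in the most general sense) a permutation of $R\cup C\cup E$ which preserves the partition $\{R,C,E\}$ (possibly permuting the three parts among themselves) and maps the set of cells onto itself (with the entries of a triple permuted accordingly when the parts are permuted). A Steiner triple system of order $n$ is a set of $3$-element subsets (blocks) of an $n$-set such that every $2$-subset lies in exactly one block; an automorphism is a permutation of the points mapping blocks to blocks. An edge-parallelism (1-factorisation) of the complete graph on an $n$-set $X$ is a partition of the set of $2$-subsets of $X$ into parallel classes, each of which is a partition of $X$ into $2$-subsets (a perfect matching); an automorphism is a permutation of $X$ mapping each parallel class onto a parallel class. A non-trivial automorphism is one different from the identity. *)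

(* Defs.v *)
From mathcomp Require Import all_boot all_order all_fingroup all_algebra.
Set Implicit Arguments. Unset Strict Implicit. Unset Printing Implicit Defensive.

Definition latin (n : nat) (L : {ffun 'I_n * 'I_n -> 'I_n}) : bool :=
  [forall i : 'I_n, injectiveb (fun j : 'I_n => L (i, j))] &&
  [forall j : 'I_n, injectiveb (fun i : 'I_n => L (i, j))].

(* A cell is a triple t : 'I_3 -> 'I_n with t 0 = row, t 1 = column,
   t 2 = symbol. *)
Definition cells (n : nat) (L : {ffun 'I_n * 'I_n -> 'I_n}) :
  {set {ffun 'I_3 -> 'I_n}} :=
  [set t : {ffun 'I_3 -> 'I_n} | L (t ord0, t (inord 1)) == t (inord 2)].

(* A permutation of R u C u E preserving the partition {R,C,E} is given by a
   permutation s of the three parts and bijections f k : part k -> part (s k).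
   It sends the element x of part k to f k x in part s k, hence the triple t to
   the triple t' with t' (s k) = f k (t k). *)
Definition mapcell (n : nat) (s : {perm 'I_3}) (f : {ffun 'I_3 -> {perm 'I_n}})
  (t : {ffun 'I_3 -> 'I_n}) : {ffun 'I_3 -> 'I_n} :=
  [ffun k => f (s^-1 k)%g (t (s^-1 k)%g)].

Definition latin_aut (n : nat) (L : {ffun 'I_n * 'I_n -> 'I_n})
  (s : {perm 'I_3}) (f : {ffun 'I_3 -> {perm 'I_n}}) : bool :=
  [set mapcell s f t | t in cells L] == cells L.

Definition latin_nontriv_aut (n : nat) (L : {ffun 'I_n * 'I_n -> 'I_n}) : bool :=
  [exists s : {perm 'I_3}, exists f : {ffun 'I_3 -> {perm 'I_n}},
     latin_aut L s f && ((s != 1%g) || [exists k, f k != 1%g])].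

Definition LatinSquares (n : nat) : {set {ffun 'I_n * 'I_n -> 'I_n}} :=
  [set L | latin L].
Definition LatinSquaresStar (n : nat) : {set {ffun 'I_n * 'I_n -> 'I_n}} :=
  [set L | latin L && latin_nontriv_aut L].

Definition sts (n : nat) (B : {set {set 'I_n}}) : bool :=
  [forall b in B, #|b| == 3] &&
  [forall x : 'I_n, forall y : 'I_n,
     (x != y) ==> (#|[set b in B | (x \in b) && (y \in b)]| == 1)].

Definition sts_aut (n : nat) (B : {set {set 'I_n}}) (p : {perm 'I_n}) : bool :=
  [set [set p x | x in b] | b : {set 'I_n} in B] == B.

Definition STS (n : nat) : {set {set {set 'I_n}}} := [set B | sts B].
Definition STSStar (n : nat) : {set {set {set 'I_n}}} :=
  [set B | sts B && [exists p : {perm 'I_n}, sts_aut B p && (p != 1%g)]].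

Definition sts_admissible (n : nat) : bool := (n %% 6 == 1) || (n %% 6 == 3).

Definition edges (n : nat) : {set {set 'I_n}} := [set e : {set 'I_n} | #|e| == 2].

Definition perfect_matching (n : nat) (C : {set {set 'I_n}}) : bool :=
  partition C [set: 'I_n] && [forall e in C, #|e| == 2].

Definition parallelism (n : nat) (P : {set {set {set 'I_n}}}) : bool :=
  partition P (edges n) && [forall C in P, perfect_matching C].

Definition par_aut (n : nat) (P : {set {set {set 'I_n}}}) (p : {perm 'I_n}) : bool :=
  [set [set [set p x | x in e] | e : {set 'I_n} in C] | C : {set {set 'I_n}} in P] == P.

Definition Par (n : nat) : {set {set {set {set 'I_n}}}} := [set P | parallelism P].
Definition ParStar (n : nat) : {set {set {set {set 'I_n}}}} :=
  [set P | parallelism P && [exists p : {perm 'I_n}, par_aut P p && (p != 1%g)]].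

(* Main.v *)
Require Import Defs.
From mathcomp Require Import all_boot all_order all_fingroup all_algebra.
From mathcomp Require Import zify ring lra.
Import Order.TTheory GRing.Theory Num.Theory.

Set Implicit Arguments. Unset Strict Implicit. Unset Printing Implicit Defensive.

(** Each structure is a set of cells.  If it is invariant under a fixed non-identity
permutation, at most a quarter of its cells (up to [O(n)]) are fixed, because the fixed
points span a substructure of at most half the order; the structure is then determined by
at most 5/8 of its cells, one entry of at most [n] values per orbit.  So the objects with a
given non-trivial automorphism number at most [n ^ (5/8 A + O(n))], where [A] is the number
of cells, and there are only [n ^ O(n)] candidate automorphisms.

For the other direction one needs [n ^ (A - O(n^2 / log n))] objects.  A [k]-regular
bipartite graph on [n + n] vertices has at least [(k/4)^n] perfect matchings, so filling a
Latin square row by row gives [n ^ (n^2)] of them up to [C ^ (n^2)].  The matching bound is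
proved in Gurvits' style, column by column, from the capacity [k^n] of
[prod_r sum_c a_rc x_c]; the log-concavity it needs, usually derived from real stability,
comes here from exchanging two partial matchings along an alternating path.  Splitting the
points into halves turns Latin squares into symmetric Latin squares with a constant,
identical or two-to-one diagonal; these are the 1-factorisations, and three of them feed the
constructions of Bose and Skolem for Steiner triple systems. *)

(** * A permanent inequality *)

(** The two bounds differ by a power [n ^ (c * n^2)] with [c > 0], which for large [n] swallows
    every factor [C ^ (n^2)]; so the matching bound, the estimate of [n!] and the halving steps may
    all lose a constant per cell. The figure 5/8 is (1 + 1/4) / 2, because an orbit of cells that
    are not fixed has at least two members. Symmetric squares resist filling row by row: earlier
    rows dictate entries of later ones, and what remains is not a regular bipartite graph. Halving
    avoids this. Of about [2 t^2] free entries of a symmetric square of order [2 t], an arbitrary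
    Latin square supplies [t^2] and the two diagonal blocks supply the rest. Parity decides what
    these blocks can be: in a symmetric Latin square of odd order every symbol lies exactly once on
    the diagonal, so constant diagonals exist only in even order, and odd blocks are obtained from
    unipotent squares of order one more. *)

Section Swap.
Variables (I J : finType) (T : {set J}) (j : J).
Implicit Types (h : {ffun I -> J}) (r : I) (D : {set I}).

Definition hit h (c : J) : nat := #|[set r | h r == c]|.
Definition hit_once h : bool := [forall c in T, hit h c == 1].

Lemma hit1P h c : reflect (exists p, forall r, (h r == c) = (r == p)) (hit h c == 1).
Proof.
apply: (iffP cards1P) => -[p hp]; exists p.
  by move=> r; move/setP/(_ r): hp; rewrite !inE.
by apply/setP=> r; rewrite !inE.
Qed.

Lemma hit_onceP h c : hit_once h -> c \in T -> exists p, forall r, (h r == c) = (r == p).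
Proof. by move=> /forall_inP hh cT; apply/hit1P/hh. Qed.

Lemma hit_once_inj h p q : hit_once h -> h p \in T -> h p = h q -> p = q.
Proof.
move=> oh pT e; have [x hx] := hit_onceP oh pT.
have := hx q; rewrite -e eqxx => /esym/eqP ->.
by have := hx p; rewrite eqxx => /esym/eqP.
Qed.

(** A step follows the [h0]-edge of a row to a column of [T] and returns along an [h1]-edge, so a
    walk alternates between the two maps. *)
Definition swap_rel h0 h1 : rel I := fun r r' => (h0 r \in T) && (h1 r' == h0 r).
Definition swap_dom h0 h1 r : {set I} := [set r' | connect (swap_rel h0 h1) r r'].
Definition mix D h0 h1 : {ffun I -> J} := [ffun r => if r \in D then h1 r else h0 r].

Lemma mixK D h0 h1 : mix D (mix D h0 h1) (mix D h1 h0) = h0.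
Proof. by apply/ffunP=> r; rewrite !ffunE; case: (r \in D). Qed.

Hypothesis jT : j \notin T.

Section Pair.
Variables (h0 h1 : {ffun I -> J}) (r0 : I).
Hypotheses (o0 : hit_once h0) (o1 : hit_once h1) (hr0 : h1 r0 = j).
Let D := swap_dom h0 h1 r0.

Lemma swap_dom_root : r0 \in D.
Proof. by rewrite inE connect0. Qed.

Lemma swap_dom_pred p : p \in D -> p != r0 ->
  exists2 q, q \in D & (h0 q \in T) && (h1 p == h0 q).
Proof.
rewrite inE => /connectP [s]; case/lastP: s => [|s x] /=; first by move=> _ -> /eqP.
rewrite rcons_path last_rcons => /andP[ps e] -> _; exists (last r0 s) => //.
by rewrite inE; apply/connectP; exists s.
Qed.

Lemma swap_dom_hit p : p \in D -> p != r0 -> h1 p \in T.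
Proof. by move=> pD /(swap_dom_pred pD) [q _ /andP[qT /eqP ->]]. Qed.

(** The [h1]-edge of [r0] ends outside [T], so the root has no predecessor, and any other row of the
    path has a unique one. Hence the two rows serving a column of [T] are exchanged together or not
    at all, which preserves [hit_once]. *)
Lemma swap_dom_closed p0 p1 : h0 p0 = h1 p1 -> h0 p0 \in T -> (p0 \in D) = (p1 \in D).
Proof.
move=> e eT; apply/idP/idP => [pD|pD].
  by move: pD; rewrite !inE => /connect_trans; apply; apply: connect1; rewrite /swap_rel eT e /=.
have [p1r|p1r] := eqVneq p1 r0; first by move: eT; rewrite e p1r hr0 (negbTE jT).
have [q qD /andP[qT /eqP e']] := swap_dom_pred pD p1r.
by rewrite (hit_once_inj o0 eT (etrans e e')).
Qed.

Lemma hit_once_mix0 : hit_once (mix D h0 h1).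
Proof.
apply/forall_inP=> c cT; apply/hit1P.
have [p0 hp0] := hit_onceP o0 cT; have [p1 hp1] := hit_onceP o1 cT.
have e0 : h0 p0 = c by apply/eqP; rewrite hp0.
have e1 : h1 p1 = c by apply/eqP; rewrite hp1.
have cl : (p0 \in D) = (p1 \in D) by apply: swap_dom_closed; rewrite ?e0 ?e1.
exists (if p0 \in D then p1 else p0) => r; rewrite ffunE.
case: ifP => rD; rewrite ?hp0 ?hp1; case: ifP => p0D //.
  by apply/eqP/eqP=> [|] rE; move: rD; rewrite rE -?cl p0D.
by apply/eqP/eqP=> [|] rE; move: rD; rewrite rE -?cl p0D.
Qed.

Lemma hit_once_mix1 : hit_once (mix D h1 h0).
Proof.
apply/forall_inP=> c cT; apply/hit1P.
have [p0 hp0] := hit_onceP o0 cT; have [p1 hp1] := hit_onceP o1 cT.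
have e0 : h0 p0 = c by apply/eqP; rewrite hp0.
have e1 : h1 p1 = c by apply/eqP; rewrite hp1.
have cl : (p0 \in D) = (p1 \in D) by apply: swap_dom_closed; rewrite ?e0 ?e1.
exists (if p0 \in D then p0 else p1) => r; rewrite ffunE.
case: ifP => rD; rewrite ?hp0 ?hp1; case: ifP => p0D //.
  by apply/eqP/eqP=> [|] rE; move: rD; rewrite rE -?cl p0D.
by apply/eqP/eqP=> [|] rE; move: rD; rewrite rE -?cl p0D.
Qed.

Hypothesis h0j : hit h0 j = 0.

Lemma h0_neq r : h0 r != j.
Proof.
apply/eqP=> e; move/eqP: h0j; rewrite cards_eq0 => /eqP/setP/(_ r).
by rewrite !inE e eqxx.
Qed.

Lemma mix0_hit r : (mix D h0 h1 r == j) = (r == r0).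
Proof.
rewrite ffunE; case: ifP => rD.
  have [->|rr] := eqVneq r r0; first by rewrite hr0 eqxx.
  by apply/negbTE/eqP=> e; move: (swap_dom_hit rD rr); rewrite e (negbTE jT).
rewrite (negbTE (h0_neq r)); apply/esym/negbTE/eqP=> e.
by move: rD; rewrite e swap_dom_root.
Qed.

Lemma mix1_hit : hit h1 j = (hit (mix D h1 h0) j).+1.
Proof.
rewrite /hit (cardsD1 r0) inE hr0 eqxx add1n; congr _.+1; apply: eq_card => r.
rewrite !inE ffunE; case: ifP => rD; last first.
  by case: (eqVneq r r0) => // e; move: rD; rewrite e swap_dom_root.
rewrite (negbTE (h0_neq r)); case: (eqVneq r r0) => //= rr.
by apply/negbTE/eqP=> e; move: (swap_dom_hit rD rr); rewrite e (negbTE jT).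
Qed.

(** Makes the exchange invertible. Inside [D] the relation is unchanged, and no walk leaves [D],
    because a row outside would share its [h0]-column in [T] with a row inside. *)
Lemma swap_dom_mix : swap_dom (mix D h1 h0) (mix D h0 h1) r0 = D.
Proof.
have cl p q : p \in D -> h0 p \in T -> h1 q = h0 p -> q \in D.
  by move=> pD pT e; rewrite -(swap_dom_closed (esym e) pT).
apply/setP=> x; apply/idP/idP.
  rewrite inE => /connectP [s ps ->] {x}.
  elim/last_ind: s ps => [|s y IH] /=; first by rewrite swap_dom_root.
  rewrite rcons_path last_rcons => /andP[/IH lD]; rewrite /swap_rel !ffunE lD.
  case: ifP => // yD /andP[lT /eqP e].
  by move: yD; rewrite -(hit_once_inj o0 lT (esym e)) lD.
rewrite inE => /connectP [s ps ->] {x}.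
have : (last r0 s \in D) && (last r0 s \in swap_dom (mix D h1 h0) (mix D h0 h1) r0).
  elim/last_ind: s ps => [|s y IH] /=; first by rewrite swap_dom_root inE connect0.
  rewrite rcons_path last_rcons => /andP[/IH /andP[lD lc]] /andP[lT /eqP e].
  have yD : y \in D by apply: cl lT e.
  rewrite yD /=; move: lc; rewrite !inE => /connect_trans; apply; apply: connect1.
  by rewrite /swap_rel !ffunE lD yD lT e eqxx.
by case/andP.
Qed.

End Pair.

Variables (K : realFieldType) (w : I -> J -> K).
Hypothesis w_ge0 : forall r c, (0 <= w r c)%R.
Local Open Scope ring_scope.

Definition hit_weight h : K := \prod_r w r (h r).
(** When the weights of column [j] are scaled by [t], this is the coefficient of [t ^ m]. *)
Definition hit_sum m : K := \sum_(h | hit_once h && (hit h j == m)) hit_weight h.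

Lemma hit_weight_ge0 h : 0 <= hit_weight h.
Proof. by apply: prodr_ge0. Qed.

Lemma hit_sum_ge0 m : 0 <= hit_sum m.
Proof. by apply: sumr_ge0 => h _; apply: hit_weight_ge0. Qed.

Definition swap_pair (p : {ffun I -> J} * {ffun I -> J}) :=
  if [pick r | p.2 r == j] is Some r then
    let D := swap_dom p.1 p.2 r in (mix D p.1 p.2, mix D p.2 p.1)
  else p.

Lemma hit_weight_mix D h0 h1 :
  hit_weight (mix D h0 h1) * hit_weight (mix D h1 h0) = hit_weight h0 * hit_weight h1.
Proof.
rewrite /hit_weight -!big_split; apply: eq_bigr => r _ /=; rewrite !ffunE.
by case: ifP => // _; rewrite mulrC.
Qed.

(* Swapping [h0] and [h1] along the alternating path that starts at a row sent to [j]
   moves one hit of [j] from [h1] to [h0]; the path can be read off from the result. *)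
Lemma hit_sum_log_concave m : hit_sum m.+1 * hit_sum 0 <= hit_sum m * hit_sum 1.
Proof.
pose A a b := [set p : {ffun I -> J} * {ffun I -> J} |
  (hit_once p.1 && (hit p.1 j == a)) && (hit_once p.2 && (hit p.2 j == b))].
have sumA a b : hit_sum a * hit_sum b = \sum_(p in A a b) hit_weight p.1 * hit_weight p.2.
  rewrite /hit_sum big_distrlr pair_big /=; apply: eq_bigl => p; by rewrite inE.
rewrite mulrC [X in _ <= X]mulrC !sumA.
have key p : p \in A 0 m.+1 -> exists r, [/\ p.2 r = j,
    swap_pair p = (mix (swap_dom p.1 p.2 r) p.1 p.2, mix (swap_dom p.1 p.2 r) p.2 p.1),
    hit_once p.1, hit_once p.2 & hit p.1 j = 0%N /\ hit p.2 j = m.+1].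
  rewrite inE => /andP[/andP[o0 /eqP z0] /andP[o1 /eqP z1]]; rewrite /swap_pair.
  case: pickP => [r /eqP hr|none]; first by exists r.
  by move: z1; rewrite /hit (eq_card (B := pred0)) ?card0 // => r; rewrite inE none.
have inj : {in A 0 m.+1 &, injective swap_pair}.
  move=> p q /key [r [pr -> o0 o1 [z0 z1]]] /key [r' [qr -> o0' o1' [z0' z1']]] [e1 e2].
  (* The root is visible in the image: it is the only row that the first component sends to [j]. *)
  have rr : r' = r.
    apply/esym/eqP; rewrite -(mix0_hit qr z0') -e1.
    by rewrite (mix0_hit pr z0).
  subst r'.
  have dd : swap_dom p.1 p.2 r = swap_dom q.1 q.2 r.
    by rewrite -(swap_dom_mix o0 pr) // -[RHS](swap_dom_mix o0' qr) // e1 e2.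
  rewrite [p]surjective_pairing [q]surjective_pairing; congr (_, _).
    by rewrite -(mixK (swap_dom p.1 p.2 r) p.1 p.2) e1 e2 dd mixK.
  by rewrite -(mixK (swap_dom p.1 p.2 r) p.2 p.1) e1 e2 dd mixK.
have -> : \sum_(p in A 0 m.+1) hit_weight p.1 * hit_weight p.2 =
          \sum_(q in swap_pair @: A 0 m.+1) hit_weight q.1 * hit_weight q.2.
  rewrite (big_imset _ inj); apply: eq_bigr => p /key [r [_ -> *]].
  by rewrite hit_weight_mix.
rewrite [X in _ <= X](big_setID (swap_pair @: A 0 m.+1)) /=.
have /setIidPr -> : swap_pair @: A 0 m.+1 \subset A 1 m.
  apply/subsetP=> q /imsetP [p /key [r [pr -> o0 o1 [z0 z1]]] ->]; rewrite inE /=.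
  rewrite hit_once_mix0 ?hit_once_mix1 //=.
  move: z1; rewrite (mix1_hit pr z0) => -[->]; rewrite eqxx !andbT.
  by apply/hit1P; exists r; apply: mix0_hit.
by rewrite lerDl sumr_ge0 // => p _; rewrite mulr_ge0 ?hit_weight_ge0.
Qed.

End Swap.

(** The hypotheses force [R m <= R 0 * rho ^ m] with [rho = R 1 / R 0]. Summing the geometric series
    at [u = t * rho] bounds [C] by [R 1 / (u * (1 - u))], which is smallest at [u = 1/2]; this is
    the 4. *)
Lemma linear_coef_ge (K : realFieldType) (R : nat -> K) (N : nat) (C : K) :
  (forall m, 0 <= R m)%R -> (forall m, R m.+1 * R 0 <= R m * R 1)%R ->
  (forall t, 0 < t -> C * t <= \sum_(m < N.+1) R m * t ^+ m)%R -> (C <= 4%:R * R 1)%R.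
Proof.
move=> R0 lc hC; have [//|lt] := lerP C (4%:R * R 1)%R; exfalso.
have C0 : (0 < C)%R by apply: le_lt_trans lt; rewrite mulr_ge0 ?ler0n.
have := R0 0; rewrite le_eqVlt => /orP[/eqP e|p].
  have lt1 : (R 1 < C)%R by have := R0 1; lra.
  pose B := (\sum_(m < N.+1) R m)%R.
  have B0 : (0 <= B)%R by apply: sumr_ge0.
  (* With [R 0 = 0] and [t <= 1], dividing by [t] leaves [C <= R 1 + B * t], which fails for small
     [t]. The [C] in the denominator keeps it positive when [B = 0]. *)
  pose t := ((C - R 1) / (C + B))%R.
  have CB : (0 < C + B)%R by lra.
  have t0 : (0 < t)%R by rewrite divr_gt0 //; lra.
  have t1 : (t <= 1)%R by rewrite ler_pdivrMr // mul1r; have := R0 1; lra.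
  have : (C * t <= R 1 * t + B * t ^+ 2)%R.
    apply: le_trans (hC _ t0) _; rewrite /B.
    elim: N {hC B B0 CB} t t0 t1 => [|N IH] t t0 t1.
      by rewrite !big_ord1 -e !mul0r addr0 mulr_ge0 // ltW.
    rewrite big_ord_recr [X in (_ + X * _)%R]big_ord_recr /= mulrDl addrA.
    case: N IH => [|N] /(_ t t0 t1) IH.
      by rewrite !big_ord1 -e !mul0r add0r addr0 lerDl mulr_ge0 // exprn_ge0 // ltW.
    apply: lerD => //; rewrite ler_wpM2l // -addn2 exprD ler_piMl ?exprn_ge0 ?(ltW t0) //.
    by rewrite exprn_ile1 // ltW.
  have -> : (R 1 * t + B * t ^+ 2 = (R 1 + B * t) * t)%R by ring.
  rewrite ler_pM2r // => h.
  have : (C * t <= 0)%R.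
    have e2 : (t * (C + B) = C - R 1)%R by rewrite /t divfK // gt_eqF.
    nra.
  by rewrite leNgt mulr_gt0.
pose rho := (R 1 / R 0)%R; have rho0 : (0 <= rho)%R by rewrite divr_ge0 // ltW.
have Rm m : (R m <= R 0 * rho ^+ m)%R.
  elim: m => [|m IH]; first by rewrite expr0 mulr1.
  rewrite -(ler_pM2r p); apply: le_trans (lc m) _.
  have -> : (R 0 * rho ^+ m.+1 * R 0 = R 0 * rho ^+ m * (rho * R 0))%R by rewrite exprS; ring.
  by rewrite /rho divfK ?gt_eqF // ler_wpM2r.
(* Chosen so that [C * t] equals [2 * R 0], strictly above the geometric sum
   [R 0 * (2 - 2 ^ -N)]. *)
pose t := (2%:R * R 0 / C)%R; have t0 : (0 < t)%R by rewrite divr_gt0 // mulr_gt0.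
have u2 : (t * rho <= 2%:R^-1)%R.
  have -> : (t * rho = 2%:R * R 1 / C)%R by rewrite /t /rho; field; rewrite !gt_eqF.
  by rewrite ler_pdivrMr //; lra.
have := hC _ t0; have -> : (C * t = 2%:R * R 0)%R by rewrite /t; field; rewrite gt_eqF.
apply/negP; rewrite -ltNge.
suff : (\sum_(m < N.+1) R m * t ^+ m <= R 0 * (2%:R - 2%:R^-1 ^+ N))%R.
  move=> /le_lt_trans; apply; rewrite mulrC ltr_pM2r // ltrBlDr ltrDl exprn_gt0 //.
  by rewrite invr_gt0.
elim: N {hC} => [|N IH]; first by rewrite big_ord1 !expr0 mulr1; lra.
rewrite big_ord_recr /=.
have : (R N.+1 * t ^+ N.+1 <= R 0 * 2%:R^-1 ^+ N.+1)%R.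
  apply: le_trans (ler_wpM2r (exprn_ge0 _ (ltW t0)) (Rm _)) _.
  rewrite -mulrA ler_wpM2l ?R0 // -exprMn lerXn2r ?nnegrE ?invr_ge0 ?ler0n //.
    by rewrite mulr_ge0 // ltW.
  by rewrite mulrC.
by rewrite [X in (R 0 * X)%R]exprS [X in (_ -> _ <= R 0 * (_ - X))%R]exprS; lra.
Qed.

(** * Perfect matchings in regular bipartite graphs *)

Section RegularBipartite.
Variables (I J : finType) (a : I -> J -> bool) (k : nat).
Hypotheses (rowk : forall r, #|[set c | a r c]| = k) (colk : forall c, #|[set r | a r c]| = k).
Local Open Scope ring_scope.

Definition graph_weight (x : J -> rat) (r : I) (c : J) : rat := (a r c)%:R * x c.
(** Interpolates between the product of the row forms ([T] empty) and the permanent times the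
    product of the [x c] ([T] everything and [#|I| = #|J|]). *)
Definition graph_sum (T : {set J}) (x : J -> rat) : rat :=
  \sum_(h : {ffun I -> J} | hit_once T h) hit_weight (graph_weight x) h.
Definition scale_at (j : J) (t : rat) (x : J -> rat) c := if c == j then t * x c else x c.

Lemma graph_sum_scale T j t x : graph_sum T (scale_at j t x) =
  \sum_(m < #|I|.+1) hit_sum T j (graph_weight x) m * t ^+ m.
Proof.
have wE h : hit_weight (graph_weight (scale_at j t x)) h =
    hit_weight (graph_weight x) h * t ^+ hit h j.
  rewrite /hit_weight /hit -prodr_const.
  rewrite [X in _ = _ * X](eq_bigl (fun r => h r == j)); last by move=> r; rewrite inE.
  rewrite [X in _ = _ * X]big_mkcond -big_split; apply: eq_bigr => r _ /=.
  by rewrite /graph_weight /scale_at; case: ifP => _; rewrite ?mulr1 //; ring.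
rewrite /graph_sum (partition_big (fun h => inord (hit h j) : 'I_#|I|.+1) predT) //=.
apply: eq_bigr => m _; rewrite /hit_sum big_distrl /=.
have hm (h : {ffun I -> J}) : (inord (hit h j) == m) = (hit h j == m :> nat).
  by rewrite -val_eqE /= inordK // ltnS; apply: max_card.
rewrite (eq_bigl (fun h => hit_once T h && (hit h j == m))); last by move=> h; rewrite hm.
by apply: eq_bigr => h /andP[_ /eqP <-]; apply: wE.
Qed.

(** AM-GM bounds each row form below by [k] times the geometric mean of its [k] variables, and each
    variable occurs in [k] rows. Raising to the power [k] avoids roots in [rat]. *)
Lemma graph_sum0 x : (forall c, 0 < x c) -> #|I| = #|J| ->
  k%:R ^+ #|I| * \prod_c x c <= graph_sum set0 x.
Proof.
move=> x0 IJ; have -> : graph_sum set0 x = \prod_r \sum_c graph_weight x r c.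
  rewrite bigA_distr_bigA /graph_sum; apply: eq_bigl => h; apply/forall_inP => c.
  by rewrite inE.
have sE r : \sum_c graph_weight x r c = \sum_(c in [set c | a r c]) x c.
  rewrite [RHS]big_mkcond; apply: eq_bigr => c _; rewrite inE /graph_weight.
  by case: (a r c); rewrite ?mul1r ?mul0r.
have s0 r : 0 <= \sum_c graph_weight x r c by rewrite sE sumr_ge0 // => c _; apply: ltW.
have p0 : 0 <= \prod_c x c by apply: prodr_ge0 => c _; apply: ltW.
case: (posnP k) => [k0|kpos].
  have [I0|Ipos] := posnP #|I|.
    rewrite I0 expr0 mul1r !big1 // => i _; exfalso.
      by have := fintype0 (T := I) i; rewrite I0; apply.
    by have := fintype0 (T := J) i; rewrite -IJ I0; apply.
  by rewrite k0 expr0n gtn_eqF // mul0r prodr_ge0.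
rewrite -(ler_pXn2r kpos) ?nnegrE ?mulr_ge0 ?exprn_ge0 ?ler0n ?p0 ?prodr_ge0 //.
have -> : (k%:R ^+ #|I| * \prod_c x c) ^+ k =
    \prod_r (k%:R ^+ k * \prod_(c in [set c | a r c]) x c).
  rewrite big_split /= prodr_const exprMn -exprM mulnC exprM; congr (_ * _).
  have -> : \prod_r \prod_(c in [set c | a r c]) x c = \prod_r \prod_(c | a r c) x c.
    by apply: eq_bigr => r _; apply: eq_bigl => c; rewrite inE.
  rewrite (exchange_big_dep xpredT) //= -prodrXl; apply: eq_bigr => c _.
  by rewrite -(colk c) -prodr_const; apply: eq_bigl => r; rewrite inE.
rewrite -prodrXl; apply: ler_prod => r _; apply/andP; split.
  by rewrite mulr_ge0 ?exprn_ge0 ?ler0n // prodr_ge0 // => c _; apply: ltW.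
have [+ _] := @leif_AGM _ J (mem [set c | a r c]) x (fun c _ => ltW (x0 c)).
rewrite -sE rowk exprMn exprVn ler_pdivlMr 1?mulrC //.
by rewrite exprn_gt0 // ltr0n.
Qed.

(** Moving [j] into [T] extracts the linear coefficient of a polynomial in [t]; its lower bound
    [C * t] is the induction hypothesis at weights rescaled in [j]. Hence the quantification over
    positive [x] and one factor 4 per column. *)
Lemma graph_sum_ge (T : {set J}) x : (forall c, 0 < x c) -> #|I| = #|J| ->
  k%:R ^+ #|I| * \prod_c x c <= 4%:R ^+ #|T| * graph_sum T x.
Proof.
move=> + IJ; move Tm: #|T| => m; elim: m T Tm x => [|m IH] T Tm x x0.
  by rewrite (cards0_eq Tm) expr0 mul1r graph_sum0.
have [j jT] : exists j, j \in T by apply/set0Pn; rewrite -cards_eq0 Tm.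
pose T' := T :\ j; have jT' : j \notin T' by rewrite !inE eqxx.
have Tm' : #|T'| = m by move: Tm; rewrite (cardsD1 j) jT => -[].
pose R := hit_sum T' j (graph_weight x).
have w0 r c : 0 <= graph_weight x r c by rewrite mulr_ge0 ?ler0n // ltW.
have -> : graph_sum T x = R 1%N.
  apply: eq_bigl => h; rewrite /hit_once; apply/forall_inP/andP => [H|[/forall_inP H hj] c cT].
    split; last exact: H.
    by apply/forall_inP=> c; rewrite inE => /andP[_ /H].
  by have [->//|cj] := eqVneq c j; apply: H; rewrite !inE cj.
have four m' : 0 < 4%:R ^+ m' :> rat by rewrite exprn_gt0.
rewrite exprSr -mulrA -ler_pdivrMl //; apply: (@linear_coef_ge _ R #|I|).
- by move=> n; apply: hit_sum_ge0.
- by move=> n; apply: hit_sum_log_concave.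
move=> t t0; rewrite -graph_sum_scale.
have x0' c : 0 < scale_at j t x c by rewrite /scale_at; case: ifP; rewrite ?mulr_gt0.
have := IH _ Tm' _ x0'.
have -> : \prod_c scale_at j t x c = (\prod_c x c) * t.
  rewrite (bigD1 j) //= [in RHS](bigD1 j) //= /scale_at eqxx.
  rewrite (eq_bigr x) => [|c /negbTE -> //]; ring.
by rewrite -ler_pdivrMl // !mulrA.
Qed.

Lemma regular_bipartite_matchings : #|I| = #|J| ->
  (k ^ #|I| <= 4 ^ #|I| * #|[set h : {ffun I -> J} | injectiveb h && [forall r, a r (h r)]]|)%N.
Proof.
move=> IJ; have := @graph_sum_ge setT (fun=> 1) (fun=> ltr01) IJ.
rewrite big1 // mulr1 cardsT -IJ -(ler_nat rat) natrM !natrX => H.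
apply: le_trans H _; rewrite ler_wpM2l ?exprn_ge0 //.
rewrite -sum1_card natr_sum /graph_sum big_mkcond [X in _ <= X]big_mkcond ler_sum // => h _.
rewrite inE /hit_once /hit_weight; case: ifP => [/forall_inP once|_]; last by case: ifP.
have -> /= : injectiveb h.
  apply/injectiveP => r r' e; have /hit1P [p hp] := once (h r) (in_setT _).
  by have := hp r'; have := hp r; rewrite -e eqxx => /esym/eqP -> /esym/eqP ->.
case: ifP => [/forallP H|/negbT/forallPn [r /negbTE nr]].
  by rewrite big1 // => r _; rewrite /graph_weight mulr1 H.
by rewrite (bigD1 r) //= /graph_weight nr !mul0r.
Qed.

End RegularBipartite.

(** * Counting Latin squares *)

Lemma leq_card_inj (T T' : finType) (f : T -> T') (A : {pred T}) (B : {pred T'}) :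
  {in A &, injective f} -> {in A, forall x, f x \in B} -> #|A| <= #|B|.
Proof.
move=> inj AB; rewrite -(card_in_imset inj); apply: subset_leq_card.
by apply/subsetP=> y /imsetP [x xA ->]; apply: AB.
Qed.

Lemma card_sigma_set (T T' : finType) (A : {set T}) (B : T -> {set T'}) :
  #|[set p | (p.1 \in A) && (p.2 \in B p.1)]| = \sum_(a in A) #|B a|.
Proof.
rewrite -sum1_card (eq_bigr (fun a => \sum_(b in B a) 1)); last by move=> a _; rewrite sum1_card.
by rewrite pair_big_dep; apply: eq_bigl => p; rewrite inE.
Qed.

Definition Lat (X Y S : finType) : {set {ffun X * Y -> S}} :=
  [set L : {ffun X * Y -> S} | [forall x, injectiveb (fun y => L (x, y))] &&
    [forall y, injectiveb (fun x => L (x, y))]].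

Lemma LatP (X Y S : finType) (L : {ffun X * Y -> S}) :
  reflect ((forall x y y', L (x, y) = L (x, y') -> y = y') /\
           (forall y x x', L (x, y) = L (x', y) -> x = x')) (L \in Lat X Y S).
Proof.
rewrite inE; apply: (iffP andP) => -[].
  move=> /forallP r /forallP c; split=> [x y y'|y x x'].
    exact: (injectiveP _ (r x)).
  exact: (injectiveP _ (c y)).
by move=> r c; split; apply/forallP=> x; apply/injectiveP; [apply: r|apply: c].
Qed.

Section LatinRectangles.
Variables (X Y S : finType) (n : nat) (L0 : {ffun X * Y -> S}).
Hypotheses (Yn : #|Y| = n) (Sn : #|S| = n).
Implicit Types (T : {set X}) (L : {ffun X * Y -> S}).

(* Functions that are Latin on the rows in [T] and agree with the junk value [L0] on the others. *)
Definition rect T := [set L : {ffun X * Y -> S} |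
  [&& [forall x in T, injectiveb (fun y => L (x, y))],
      [forall y, forall x in T, forall x' in T, (L (x, y) == L (x', y)) ==> (x == x')] &
      [forall x in ~: T, forall y, L (x, y) == L0 (x, y)]]].

Lemma rectP T L : reflect
  [/\ forall x y y', x \in T -> L (x, y) = L (x, y') -> y = y',
      forall y x x', x \in T -> x' \in T -> L (x, y) = L (x', y) -> x = x' &
      forall x y, x \notin T -> L (x, y) = L0 (x, y)] (L \in rect T).
Proof.
rewrite inE; apply: (iffP and3P) => -[r c o]; split.
- by move=> x y y' /(forall_inP r)/injectiveP; apply.
- move=> y x x' xT x'T e; apply/eqP.
  by have /forallP/(_ y)/forall_inP/(_ _ xT)/forall_inP/(_ _ x'T)/implyP := c; apply; apply/eqP.
- by move=> x y xT; apply/eqP; move: y; apply/forallP; apply: (forall_inP o); rewrite inE.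
- by apply/forall_inP=> x xT; apply/injectiveP=> y y'; apply: r.
- apply/forallP=> y; apply/forall_inP=> x xT; apply/forall_inP=> x' x'T; apply/implyP=> /eqP.
  by move/(c _ _ _ xT x'T) ->.
- by apply/forall_inP=> x; rewrite inE => xT; apply/forallP=> y; apply/eqP; apply: o.
Qed.

Definition free_symbol T L y s := [forall x in T, L (x, y) != s].

Lemma card_row T L x s : L \in rect T -> x \in T -> #|[set y | L (x, y) == s]| = 1.
Proof.
move=> /rectP [r _ _] xT.
have [g gK Kg] : bijective (fun y => L (x, y)).
  by apply: inj_card_bij; [move=> y y'; apply: r | rewrite Sn Yn].
apply/eqP/cards1P; exists (g s); apply/setP=> y; rewrite !inE.
by apply/eqP/eqP=> [<-|->]; rewrite ?gK ?Kg.
Qed.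

Lemma card_free_row T L y : L \in rect T -> #|[set s | free_symbol T L y s]| = n - #|T|.
Proof.
move=> /rectP [_ c _]; have inj : {in T &, injective (fun x => L (x, y))}.
  by move=> x x' xT x'T; apply: c.
rewrite [LHS]cardsCs Sn -(card_in_imset inj); congr (_ - _); apply: eq_card => s.
rewrite !inE; apply/forall_inPn/imsetP => -[x xT e]; exists x => //.
  by apply/esym/eqP; rewrite negbK in e.
by rewrite negbK e.
Qed.

Lemma card_free_col T L s : L \in rect T -> #|[set y | free_symbol T L y s]| = n - #|T|.
Proof.
move=> LT; have /rectP [_ c _] := LT.
rewrite [LHS]cardsCs Yn; congr (_ - _).
transitivity (\sum_(x in T) #|[set y | L (x, y) == s]|); last first.
  by rewrite (eq_bigr (fun=> 1)) ?sum1_card // => x xT; apply: card_row LT xT.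
rewrite -sum1_card big_mkcond /=.
transitivity (\sum_y \sum_(x in T) (L (x, y) == s : nat)); last first.
  rewrite exchange_big /=; apply: eq_bigr => x xT.
  by rewrite -sum1_card [RHS]big_mkcond; apply: eq_bigr => y _; rewrite inE; case: eqP.
apply: eq_bigr => y _; rewrite !inE.
case: ifP => [|/negbT]; rewrite ?negbK; last first.
  by move=> /forall_inP H; rewrite big1 // => x xT; rewrite (negbTE (H x xT)).
case/forall_inPn=> x xT; rewrite negbK => e; rewrite (bigD1 x) //= e big1 // => x' /andP[x'T ne].
apply/eqP; rewrite eqb0; apply: contra ne => /eqP e'; apply/eqP.
exact: (c y _ _ x'T xT (etrans e' (esym (eqP e)))).
Qed.

(** Columns and their free symbols form a regular bipartite graph of degree [n - #|T|], and a new
    row is a perfect matching in it. *)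
Lemma card_rectS T x0 : x0 \notin T ->
  (n - #|T|) ^ n * #|rect T| <= 4 ^ n * #|rect (x0 |: T)|.
Proof.
move=> x0T.
pose M L := [set h : {ffun Y -> S} | injectiveb h && [forall y, free_symbol T L y (h y)]].
apply: (@leq_trans (4 ^ n * \sum_(L in rect T) #|M L|)).
  rewrite mulnC -sum_nat_const big_distrr /=; apply: leq_sum => L LT.
  rewrite -{2 3}Yn; apply: (@regular_bipartite_matchings _ _ (free_symbol T L)) => [y|s|].
  - exact: card_free_row.
  - exact: card_free_col.
  - by rewrite Yn Sn.
rewrite leq_mul2l -card_sigma_set; apply/orP; right.
pose f (p : {ffun X * Y -> S} * {ffun Y -> S}) : {ffun X * Y -> S} :=
  [ffun q => if q.1 == x0 then p.2 q.2 else p.1 q].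
apply: (@leq_card_inj _ _ f) => [[L h] [L' h']|[L h]].
  rewrite inE => /andP[/rectP[_ _ o] _]; rewrite inE => /andP[/rectP[_ _ o'] _] /ffunP e.
  congr (_, _).
    apply/ffunP=> -[x y]; have := e (x, y); rewrite !ffunE /=.
    by case: eqP => [-> _|//]; rewrite o // o'.
  by apply/ffunP=> y; have := e (x0, y); rewrite !ffunE eqxx.
rewrite inE /= => /andP[/rectP[r c o]]; rewrite inE => /andP[/injectiveP ih /forallP fh].
apply/rectP; split=> [x y y'|y x x'|x y].
- by rewrite !inE !ffunE /=; case: eqP => [_ _ /ih|_ /=] //; apply: r.
- have ff z : z \in T -> L (z, y) != h y by move=> zT; have /forall_inP/(_ z zT) := fh y.
  rewrite !inE !ffunE /=.
  case: (eqVneq x x0) => [->|_] /=; case: (eqVneq x' x0) => [->|_] //= xT x'T.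
  + by move=> /esym/eqP; rewrite (negbTE (ff _ x'T)).
  + by move=> /eqP; rewrite (negbTE (ff _ xT)).
  + exact: c.
- by rewrite !inE !ffunE /= negb_or => /andP[/negbTE -> xT]; apply: o.
Qed.

Lemma card_rect T : (n ^_ #|T|) ^ n <= 4 ^ (n * #|T|) * #|rect T|.
Proof.
move Tm: #|T| => m; elim: m T Tm => [|m IH] T Tm.
  rewrite ffactn0 exp1n muln0 mul1n (cards0_eq Tm); apply/card_gt0P; exists L0.
  by apply/rectP; split=> [x y y'|y x x'|//]; rewrite inE.
have [x xT] : exists x, x \in T by apply/set0Pn; rewrite -cards_eq0 Tm.
have Tm' : #|T :\ x| = m by move: Tm; rewrite (cardsD1 x) xT => -[].
rewrite -(setD1K xT) ffactnSr expnMn mulnS expnD.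
apply: (@leq_trans (4 ^ (n * m) * #|rect (T :\ x)| * (n - m) ^ n)).
  by rewrite leq_mul2r IH ?orbT.
have xT' : x \notin T :\ x by rewrite !inE eqxx.
have := card_rectS xT'; rewrite Tm' => H.
rewrite -mulnA [X in _ * X <= _]mulnC [4 ^ n * _]mulnC -[X in _ <= X]mulnA.
by rewrite leq_mul2l H orbT.
Qed.

End LatinRectangles.

(** The product [(n + 1) ... (2 n)] is [n!] times a central binomial coefficient, and the latter is
    at most [2 ^ (2 n)]. *)
Lemma expnn_le_fact n : n ^ n <= 4 ^ n * n`!.
Proof.
apply: (@leq_trans ('C(n + n, n) * n`!)); last first.
  rewrite leq_mul2r; apply/orP; right.
  rewrite -[4]/(2 ^ 2) -expnM mul2n -addnn -[2]/(1 + 1) expnDn.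
  have nn : n < (n + n).+1 by rewrite ltnS leq_addr.
  by rewrite (bigD1 (Ordinal nn)) //= !exp1n !muln1 leq_addr.
rewrite bin_ffact ffact_prod -[X in _ ^ X]card_ord -prod_nat_const.
by apply: leq_prod => i _; have := ltn_ord i; lia.
Qed.

(** 16 is 4 times 4: one factor per cell from the matchings, one from the [n]-th power of
    [n ^ n <= 4 ^ n * n!]. *)
Lemma card_Lat_ge (X Y S : finType) n : #|X| = n -> #|Y| = n -> #|S| = n ->
  n ^ (n * n) <= 16 ^ (n * n) * #|Lat X Y S|.
Proof.
move=> Xn Yn Sn; have YS : #|Y| = #|S| by rewrite Yn Sn.
pose L0 : {ffun X * Y -> S} := [ffun q => enum_val (cast_ord YS (enum_rank q.2))].
have := card_rect L0 Yn Sn setT; rewrite cardsT Xn ffactnn => H.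
have -> : Lat X Y S = rect L0 setT.
  apply/setP=> L; apply/LatP/rectP => [[r c]|[r c _]].
    split=> [x y y' _|y x x' _ _|x y]; [exact: r|exact: c|by rewrite inE].
  by split=> [x y y'|y x x']; [apply: r|apply: c].
rewrite expnM; apply: (@leq_trans ((4 ^ n * n`!) ^ n)).
  have [->|n0] := posnP n; first by rewrite !expn0.
  by rewrite leq_exp2r // expnn_le_fact.
rewrite expnMn -expnM -[16]/(4 * 4) expnMn -mulnA leq_mul2l; apply/orP; right.
exact: H.
Qed.

(** * Counting symmetric Latin squares *)

Lemma eq_card_bijection (X Y : finType) : #|X| = #|Y| -> exists f : X -> Y, bijective f.
Proof.
move=> e; exists (fun x => enum_val (cast_ord e (enum_rank x))).
exists (fun y => enum_val (cast_ord (esym e) (enum_rank y))) => z.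
  by rewrite enum_valK cast_ordK enum_rankK.
by rewrite enum_valK cast_ordKV enum_rankK.
Qed.

Lemma eq_card_bijection_at (X Y : finType) x y : #|X| = #|Y| ->
  exists2 f : X -> Y, bijective f & f x = y.
Proof.
move=> /eq_card_bijection [f bf]; exists (tperm (f x) y \o f); last by rewrite /= tpermL.
by apply: bij_comp bf; apply: injF_bij; apply: perm_inj.
Qed.

Definition symLat (X S : finType) (d : X -> S) : {set {ffun X * X -> S}} :=
  [set q : {ffun X * X -> S} | [&& [forall x, forall y, q (x, y) == q (y, x)],
    [forall x, injectiveb (fun y => q (x, y))] & [forall x, q (x, x) == d x]]].

Lemma symLatP (X S : finType) (d : X -> S) (q : {ffun X * X -> S}) : reflect
  [/\ forall x y, q (x, y) = q (y, x), forall x y y', q (x, y) = q (x, y') -> y = y' &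
      forall x, q (x, x) = d x] (q \in symLat d).
Proof.
rewrite inE; apply: (iffP and3P) => -[s r e]; split.
- by move=> x y; apply/eqP; move: x y => x; apply/forallP; move: x; apply/forallP.
- by move=> x; apply/injectiveP; move: x; apply/forallP.
- by move=> x; apply/eqP; move: x; apply/forallP.
- by apply/forallP=> x; apply/forallP=> y; apply/eqP.
- by apply/forallP=> x; apply/injectiveP; apply: r.
- by apply/forallP=> x; apply/eqP.
Qed.

Lemma card_symLat_transport (X X' S S' : finType) (d : X -> S) (d' : X' -> S')
    (f : X -> X') (g : S' -> S) : bijective f -> injective g ->
  (forall x, g (d' (f x)) = d x) -> #|symLat d'| <= #|symLat d|.
Proof.
move=> bf ig dd; have injf := bij_inj bf; case: bf => f' fK Kf.
pose F (q : {ffun X' * X' -> S'}) : {ffun X * X -> S} :=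
  [ffun p => g (q (f p.1, f p.2))].
apply: (@leq_card_inj _ _ F) => [q1 q2 _ _ /ffunP e|q /symLatP[s r e]].
  by apply/ffunP=> -[x y]; have := e (f' x, f' y); rewrite !ffunE /= !Kf => /ig.
apply/symLatP; split=> [x y|x y y'|x]; rewrite !ffunE /=.
- by rewrite s.
- by move=> /ig/r/injf.
- by rewrite e dd.
Qed.

Section Blocks.
Variables (A A' S B : finType).

Definition sum_diag (d : A -> S) (d' : A' -> S) (z : A + A') : S + B :=
  match z with inl a => inl (d a) | inr a => inl (d' a) end.

Definition block_square (p : {ffun A * A -> S} * {ffun A' * A' -> S} * {ffun A * A' -> B}) :
  {ffun (A + A') * (A + A') -> S + B} :=
  [ffun z => match z with
    | (inl a, inl b) => inl (p.1.1 (a, b)) | (inr a, inr b) => inl (p.1.2 (a, b))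
    | (inl a, inr b) | (inr b, inl a) => inr (p.2 (a, b)) end].

(** Symbols of [B] occur only in the off-diagonal blocks, which are transposes of each other, so the
    Latin property can be checked block by block. *)
Lemma card_symLat_block (d : A -> S) (d' : A' -> S) :
  #|symLat d| * #|symLat d'| * #|Lat A A' B| <= #|symLat (sum_diag d d')|.
Proof.
rewrite -!cardsX; apply: (@leq_card_inj _ _ block_square).
  move=> [[q1 q2] L] [[q1' q2'] L'] _ _ /ffunP e; congr (_, _, _); apply/ffunP=> -[x y].
  - by have := e (inl x, inl y); rewrite !ffunE => -[].
  - by have := e (inr x, inr y); rewrite !ffunE => -[].
  - by have := e (inl x, inr y); rewrite !ffunE => -[].
move=> [[q1 q2] L]; rewrite !in_setX /= => /andP[/andP[/symLatP[s1 r1 e1] /symLatP[s2 r2 e2]]].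
move=> /LatP [rL cL]; apply/symLatP; split=> [x y|x y y'|x].
- by rewrite !ffunE; case: x y => x [y|y] /=; rewrite ?[q1 (x, _)]s1 ?[q2 (x, _)]s2.
- rewrite !ffunE; case: x y y' => x [y|y] [y'|y'] //= [].
  + by move/r1 ->.
  + by move/rL ->.
  + by move/cL ->.
  + by move/r2 ->.
- by rewrite ffunE; case: x => x /=; rewrite ?e1 ?e2.
Qed.

End Blocks.

Definition unipLat (A B : finType) (b0 : B) : {set {ffun A * A -> B}} :=
  [set L in Lat A A B | [forall a, L (a, a) == b0]].

(** Each row has one cell with symbol [b0]; permuting columns moves these cells to the diagonal. The
    permutation, one of at most [#|A| ^ #|A|] maps, is kept to undo the move. *)
Lemma card_unipLat (A B : finType) (b0 : B) : #|A| = #|B| ->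
  #|Lat A A B| <= #|A| ^ #|A| * #|unipLat A b0|.
Proof.
move=> AB.
pose sg (L : {ffun A * A -> B}) a := odflt a [pick b | L (a, b) == b0].
have sgE L : L \in Lat A A B -> forall a, L (a, sg L a) = b0.
  move=> /LatP[r _] a; rewrite /sg; case: pickP => [b /eqP //|none].
  have [g _ Kg] : bijective (fun b => L (a, b)) by apply: inj_card_bij; rewrite ?AB //; apply: r.
  by have := none (g b0); rewrite Kg eqxx.
have sgI L : L \in Lat A A B -> injective (sg L).
  move=> LL a a' e; have /LatP[_ c] := LL; apply: (c (sg L a)).
  by rewrite {2}e !sgE.
pose F (L : {ffun A * A -> B}) : {ffun A -> A} * {ffun A * A -> B} :=
  ([ffun a => sg L a], [ffun p => L (p.1, sg L p.2)]).
rewrite -card_ffun -cardsT -cardsX.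
apply: (@leq_card_inj _ _ F) => [L L' LL LL' [] /ffunP e /ffunP e'|L LL].
  apply/ffunP=> -[a b]; have [g _ Kg] := injF_bij (sgI _ LL).
  have := e' (a, g b); have := e (g b); rewrite !ffunE /= => <-.
  by rewrite Kg.
have /LatP[r c] := LL; rewrite in_setX in_setT inE /=; apply/andP; split.
  apply/LatP; split=> [x y y'|y x x']; rewrite !ffunE /=; last exact: c.
  by move=> /r/(sgI _ LL).
by apply/forallP=> a; rewrite !ffunE /= sgE.
Qed.

(* The blocks [q1], [q2], [L] of the block square meet in the intercalates on [inl a, inr a];
   switching them all makes the diagonal constant. *)
Definition switched_square (A B : finType) (b0 : B)
    (p : {ffun A * A -> A} * {ffun A * A -> A} * {ffun A * A -> B}) :
  {ffun (A + A) * (A + A) -> A + B} :=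
  [ffun z => match z with
    | (inl a, inl b) => if a == b then inr b0 else inl (p.1.1 (a, b))
    | (inr a, inr b) => if a == b then inr b0 else inl (p.1.2 (a, b))
    | (inl a, inr b) | (inr b, inl a) => if a == b then inl a else inr (p.2 (a, b)) end].

Lemma card_symLat_switched (A B : finType) (b0 : B) :
  #|symLat (@id A)| * #|symLat (@id A)| * #|unipLat A b0| <=
  #|symLat (fun _ : A + A => inr b0 : A + B)|.
Proof.
rewrite -!cardsX; apply: (@leq_card_inj _ _ (@switched_square A B b0)).
  move=> [[q1 q2] L] [[q1' q2'] L']; rewrite !in_setX /= ![_ \in unipLat _ _]inE.
  move=> /andP[/andP[/symLatP[_ _ e1] /symLatP[_ _ e2]] /andP[_ /forallP eL]].
  move=> /andP[/andP[/symLatP[_ _ e1'] /symLatP[_ _ e2']] /andP[_ /forallP eL']] /ffunP e.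
  congr (_, _, _); apply/ffunP=> -[x y].
  - have := e (inl x, inl y); rewrite !ffunE; case: eqP => [->|_ []//].
    by rewrite e1 e1'.
  - have := e (inr x, inr y); rewrite !ffunE; case: eqP => [->|_ []//].
    by rewrite e2 e2'.
  - have := e (inl x, inr y); rewrite !ffunE; case: eqP => [->|_ []//].
    by rewrite (eqP (eL y)) (eqP (eL' y)).
move=> [[q1 q2] L]; rewrite !in_setX /= [_ \in unipLat _ _]inE.
move=> /andP[/andP[/symLatP[s1 r1 e1] /symLatP[s2 r2 e2]] /andP[/LatP[rL cL] /forallP eL]].
have {}eL a : L (a, a) = b0 by apply/eqP.
apply/symLatP; split=> [x y|x y y'|x].
- rewrite !ffunE; case: x y => x [y|y] /=; rewrite ?(eq_sym y x) //.
  + by rewrite s1.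
  + by rewrite s2.
- have n1 u v : q1 (u, v) = u -> u = v by rewrite -{2}(e1 u) => /r1.
  have n2 u v : q2 (u, v) = u -> u = v by rewrite -{2}(e2 u) => /r2.
  have nL u v : L (u, v) = b0 -> u = v by rewrite -(eL u) => /rL.
  have nL' u v : b0 = L (u, v) -> u = v by move/esym/nL.
  have n1' u v : u = q1 (u, v) -> u = v by move/esym/n1.
  have n2' u v : u = q2 (u, v) -> u = v by move/esym/n2.
  rewrite !ffunE; case: x y y' => x [y|y] [y'|y'] //=;
    case: eqP => e; case: eqP => e' //; subst=> //= -[] e2x //; try by case: e; auto.
  all: try by case: e'; auto.
  all: try by rewrite (r1 _ _ _ e2x).
  all: try by rewrite (r2 _ _ _ e2x).
  all: try by rewrite (rL _ _ _ e2x).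
  all: try by rewrite (cL _ _ _ e2x).
- by rewrite ffunE; case: x => x; rewrite eqxx.
Qed.

(** The classical passage from a 1-factorisation on [N + 1] points to an idempotent square on [N]:
    delete [None] and rename the colour of its edge to [Some z] as [z]. The lost row of [None] is
    stored for injectivity. *)
Lemma card_symLat_option (A : finType) :
  #|symLat (fun _ : option A => None : option A)| <= #|A|.+1 ^ #|A| * #|symLat (@id A)|.
Proof.
pose row (q : {ffun option A * option A -> option A}) : {ffun A -> option A} :=
  [ffun x => q (None, Some x)].
pose sq (q : {ffun option A * option A -> option A}) : {ffun A * A -> A} :=
  [ffun p => if p.1 == p.2 then p.1 else
    odflt p.1 [pick z | q (None, Some z) == q (Some p.1, Some p.2)]].
have sqE q : q \in symLat (fun _ : option A => None : option A) -> forall x y, x != y ->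
    q (None, Some (sq q (x, y))) = q (Some x, Some y).
  move=> /symLatP[s r e] x y xy; rewrite ffunE /= (negbTE xy); case: pickP => [z /eqP //|none].
  have [g _ Kg] : bijective (fun z => q (None, z)) by apply: injF_bij => z z'; apply: r.
  case gE: (g (q (Some x, Some y))) => [z|]; last first.
    have := Kg (q (Some x, Some y)); rewrite gE e -(e (Some x)) => /r [xy'].
    by rewrite xy' eqxx in xy.
  by have := none z; rewrite -gE Kg eqxx.
rewrite -card_option -card_ffun -cardsT -cardsX.
apply: (@leq_card_inj _ _ (fun q => (row q, sq q))) => [q q' qS qS' [] /ffunP e1 e2|q qS].
  have [/symLatP[s r e] /symLatP[s' r' e']] := (qS, qS').
  have rowE x : q (None, Some x) = q' (None, Some x) by have := e1 x; rewrite !ffunE.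
  apply/ffunP=> -[[x|] [y|]]; rewrite ?e ?e' //.
  - have [->|xy] := eqVneq x y; first by rewrite e e'.
    by rewrite -(sqE _ qS) // -(sqE _ qS') // e2 rowE.
  - by rewrite s s'.
have /symLatP[s r e] := qS; rewrite in_setX in_setT /=.
have sqxx x : sq q (x, x) = x by rewrite ffunE eqxx.
have sqn x y : x != y -> sq q (x, y) != x.
  move=> xy; apply/eqP=> h; have := sqE _ qS x y xy; rewrite h s => /r //.
apply/symLatP; split=> // [x y|x y y'].
  have [->//|xy] := eqVneq x y; have yx : y != x by rewrite eq_sym.
  have := sqE _ qS x y xy; rewrite [RHS]s -(sqE _ qS y x yx) => /r [] //.
have [<-|xy] := eqVneq x y; have [<-//|xy'] := eqVneq x y'; rewrite ?sqxx.
- by move=> h; have := sqn _ _ xy'; rewrite -h eqxx.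
- by move=> h; have := sqn _ _ xy; rewrite h eqxx.
move=> h; have := sqE _ qS x y xy; rewrite h (sqE _ qS x y' xy') => /r [] //.
Qed.

(** [P] counts pairs of diagonal blocks and [Q] off-diagonal blocks. Doubling the base costs
    [2 ^ (2 t^2)], so 24 leaves 22 for the two losses. *)
Lemma combine_bounds t E1 E2 P Q : t ^ (t * t) <= 2 ^ E1 * P -> t ^ (t * t) <= 2 ^ E2 * Q ->
  E1 + E2 <= 22 * (t * t) -> (t + t) ^ (2 * (t * t)) <= 2 ^ (24 * (t * t)) * (P * Q).
Proof.
move=> h1 h2 E12.
have -> : (t + t) ^ (2 * (t * t)) = 2 ^ (2 * (t * t)) * (t ^ (t * t) * t ^ (t * t)).
  by rewrite -expnD addnn -mul2n expnMn; congr (_ * t ^ _); lia.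
have -> : 2 ^ (24 * (t * t)) = 2 ^ (2 * (t * t)) * 2 ^ (22 * (t * t)).
  by rewrite -expnD; congr (_ ^ _); lia.
rewrite -mulnA leq_mul2l; apply/orP; right.
apply: leq_trans (leq_mul h1 h2) _; rewrite mulnACA -expnD leq_mul2r leq_exp2l //.
by rewrite E12 orbT.
Qed.

(** For bases up to [2 ^ 12] the loss factor alone reaches the main term, so existence of one object
    suffices. *)
Lemma small_bound t P : t + t <= 2 ^ 12 -> 0 < P ->
  (t + t) ^ (2 * (t * t)) <= 2 ^ (24 * (t * t)) * P.
Proof.
move=> small P0; apply: leq_trans (leq_pmulr _ P0).
rewrite -[24]/(12 * 2) -[12 * 2 * _]mulnA [2 ^ (12 * _)]expnM.
by have [->//|e0] := posnP (2 * (t * t)); rewrite leq_exp2r.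
Qed.

Lemma leq_exp2 m n k : m <= n -> m ^ k <= n ^ k.
Proof. by have [->//|k0] := posnP k; rewrite leq_exp2r. Qed.

Lemma half_bound t s u : t = s + s -> t ^ (2 * (s * s)) <= 2 ^ (24 * (s * s)) * u ->
  t ^ (t * t) <= 2 ^ (12 * (t * t)) * (u * u).
Proof.
move=> ts h; have := leq_mul h h; rewrite mulnACA -!expnD.
by congr (_ ^ _ <= 2 ^ _ * _); rewrite ts; lia.
Qed.

Lemma Lat_bound (X Y S : finType) t : #|X| = t -> #|Y| = t -> #|S| = t ->
  t ^ (t * t) <= 2 ^ (4 * (t * t)) * #|Lat X Y S|.
Proof. by move=> Xt Yt St; rewrite [2 ^ _]expnM; apply: card_Lat_ge. Qed.

(** With [N = #|A|], squaring gives the exponent [(N + 1)^2 = N^2 + 2 N + 1]; the rows stored by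
    [card_symLat_option] cost [(N + 1) ^ (2 N)], which cancels. *)
Lemma idempotent_bound_of_unipotent s (A : finType) : #|A| = (s + s).+1 ->
  (s.+1 + s.+1) ^ (2 * (s.+1 * s.+1)) <=
    2 ^ (24 * (s.+1 * s.+1)) * #|symLat (fun _ : option A => None : option A)| ->
  #|A| ^ (#|A| * #|A|) <= 2 ^ (12 * (#|A|.+1 * #|A|.+1)) * (#|symLat (@id A)| * #|symLat (@id A)|).
Proof.
move=> As; have -> : s.+1 + s.+1 = #|A|.+1 by rewrite As; lia.
set N := #|A| in As *; set I := #|symLat (@id A)|; move: (card_symLat_option A).
rewrite -/N -/I => hI h.
have {h hI} h := leq_trans h (leq_mul (leqnn _) hI).
have {}h : N.+1 ^ (N + N) * N.+1 ^ (N * N).+1 <=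
    N.+1 ^ (N + N) * (2 ^ (12 * (N.+1 * N.+1)) * (I * I)).
  have := leq_mul h h.
  have -> : 12 * (N.+1 * N.+1) = 24 * (s.+1 * s.+1) + 24 * (s.+1 * s.+1) by rewrite As; lia.
  have -> : N.+1 ^ (2 * (s.+1 * s.+1)) * N.+1 ^ (2 * (s.+1 * s.+1)) =
      N.+1 ^ (N + N) * N.+1 ^ (N * N).+1.
    by rewrite -!expnD; congr (_ ^ _); rewrite As; lia.
  by move/leq_trans; apply; rewrite [N.+1 ^ (N + N)]expnD [2 ^ (_ + _)]expnD; lia.
move: h; rewrite leq_mul2l expn_eq0 /= => h; apply: leq_trans h.
by apply: leq_trans (leq_exp2 _ (leqnSn N)) _; rewrite leq_exp2l // As.
Qed.

Lemma expnn_le_exp2 t : t ^ t <= 2 ^ (t * t).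
Proof. by rewrite expnM leq_exp2 // ltnW // ltn_expl. Qed.

(** The constant 24 reproduces itself: by [half_bound] a pair of blocks of half the order loses
    [12 t^2], the Latin square loses [4 t^2], and [22 t^2] is allowed. *)
Lemma card_unipotent_ge t (X S : finType) (s0 : S) : #|X| = t + t -> #|S| = t + t ->
  (t + t) ^ (2 * (t * t)) <= 2 ^ (24 * (t * t)) * #|symLat (fun _ : X => s0)|.
Proof.
elim/ltn_ind: t X S s0 => t IH X S s0 Xt St.
have t0 : 0 < t.
  have : 0 < #|S| by apply/card_gt0P; exists s0.
  by rewrite St; lia.
pose s1 := Ordinal t0; have ct : #|'I_t| = t by rewrite card_ord.
have [f bf] : exists f : X -> 'I_t + 'I_t, bijective f.
  by apply: eq_card_bijection; rewrite card_sum ct.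
have cS : #|{: 'I_t + 'I_t}| = #|S| by rewrite card_sum ct.
have [ot|et] := boolP (odd t); last first.
  have [s ts] : exists s, t = s + s by exists t./2; rewrite addnn even_halfK.
  have st : s < t by lia.
  have := IH s st 'I_t 'I_t s1; rewrite -ts ct => /(_ erefl erefl).
  set u := #|symLat _| => hu; have hL := Lat_bound ct ct ct.
  have hu' : t ^ (t * t) <= 2 ^ (12 * (t * t)) * (u * u).
    exact: half_bound ts hu.
  apply: leq_trans (combine_bounds hu' hL _) _; first by lia.
  rewrite leq_mul2l; apply/orP; right; apply: leq_trans (card_symLat_block _ _ _) _.
  have [g bg gs] := eq_card_bijection_at (inl s1) s0 cS.
  apply: (card_symLat_transport bf (bij_inj bg)) => x.
  by case: (f x) => a /=; rewrite gs.
have [s ts] : exists s, t = (s + s).+1 by exists t./2; rewrite addnn -{1}(odd_double_half t) ot.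
have hI : t ^ (t * t) <= 2 ^ (12 * (t.+1 * t.+1)) *
    (#|symLat (@id 'I_t)| * #|symLat (@id 'I_t)|).
  (* For [t = 1], order [t + 1] is the order being counted, out of reach of the induction. *)
  case: s ts => [|s] ts.
    have : 0 < #|symLat (@id 'I_t)|.
      have all1 (a b : 'I_t) : a = b by case: a b => a ha [b hb]; apply: ord_inj => /=; lia.
      apply/card_gt0P; exists [ffun=> s1]; apply/symLatP.
      by split=> [x y|x y y' _|x]; apply: all1.
    by rewrite ts exp1n => I0; rewrite muln_gt0 expn_gt0 muln_gt0 I0.
  have := @idempotent_bound_of_unipotent s.+1 'I_t; rewrite ct; apply=> //.
  by apply: IH; rewrite ?card_option ?ct; lia.
(* 5 is 4 for the Latin squares plus 1 for the column permutations, by [t ^ t <= 2 ^ (t * t)]. *)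
have hL : t ^ (t * t) <= 2 ^ (5 * (t * t)) * #|unipLat 'I_t s1|.
  apply: leq_trans (Lat_bound ct ct ct) _.
  apply: leq_trans (leq_mul (leqnn _) (card_unipLat s1 _)) _ => //.
  rewrite ct mulnA leq_mul2r; apply/orP; right.
  apply: leq_trans (leq_mul (leqnn _) (expnn_le_exp2 t)) _.
  by rewrite -expnD leq_exp2l //; lia.
have [g bg gs] := eq_card_bijection_at (inr s1) s0 cS.
have le : #|symLat (@id 'I_t)| * #|symLat (@id 'I_t)| * #|unipLat 'I_t s1| <=
    #|symLat (fun _ : X => s0)|.
  apply: leq_trans (card_symLat_switched _ _) _.
  by apply: (card_symLat_transport bf (bij_inj bg)).
(* The detour through order [t + 1] makes the loss [12 (t + 1)^2 + 5 t^2], which exceeds [22 t^2]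
   for [t = 5] but not for larger [t]. *)
have [small|big] := leqP t 6; last first.
  apply: leq_trans (combine_bounds hI hL _) _; first by nia.
  by rewrite leq_mul2l le orbT.
apply: small_bound; first by lia.
apply: leq_trans le; rewrite muln_gt0.
have p0 : 0 < t ^ (t * t) by rewrite expn_gt0 t0.
have := leq_trans p0 hI; have := leq_trans p0 hL; rewrite !muln_gt0.
by move=> /andP[_ ->] /andP[_ ->].
Qed.

Lemma card_idempotent_ge (A : finType) : odd #|A| ->
  #|A| ^ (#|A| * #|A|) <= 2 ^ (12 * (#|A|.+1 * #|A|.+1)) * (#|symLat (@id A)| * #|symLat (@id A)|).
Proof.
move=> oA; have As : #|A| = (#|A|./2 + #|A|./2).+1.
  by rewrite addnn -{1}(odd_double_half #|A|) oA.
apply: (idempotent_bound_of_unipotent As); apply: card_unipotent_ge; rewrite card_option; lia.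
Qed.

Definition half_diag (A B : finType) (z : A + A) : A + B :=
  match z with inl a => inl a | inr a => inl a end.

(** For odd [t], both diagonal blocks are idempotent over the same symbols. For even [t], each block
    shows half of the [t] symbols twice on its diagonal, which is the same problem at half the
    order. *)
Lemma card_half_idempotent_ge t (A B : finType) : #|A| = t -> #|B| = t -> 0 < t ->
  (t + t) ^ (2 * (t * t)) <= 2 ^ (24 * (t * t)) * #|symLat (@half_diag A B)|.
Proof.
elim/ltn_ind: t A B => t IH A B At Bt t0.
have hL := Lat_bound At At Bt.
have [ot|et] := boolP (odd t); last first.
  have [s ts] : exists s, t = s + s by exists t./2; rewrite addnn even_halfK.
  have cs : #|'I_s| = s by rewrite card_ord.
  have [s0 st] : 0 < s /\ s < t by lia.
  have := IH s st 'I_s 'I_s cs cs s0; rewrite -ts.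
  set u := #|symLat _| => hu.
  have hu' : t ^ (t * t) <= 2 ^ (12 * (t * t)) * (u * u).
    exact: half_bound ts hu.
  apply: leq_trans (combine_bounds hu' hL _) _; first by lia.
  rewrite leq_mul2l; apply/orP; right.
  pose d1 := @half_diag 'I_s 'I_s.
  (* The second block carries the complementary half of the symbols on its diagonal. *)
  pose d2 (z : 'I_s + 'I_s) : 'I_s + 'I_s := match z with inl a => inr a | inr a => inr a end.
  have u2 : u <= #|symLat d2|.
    pose sw (z : 'I_s + 'I_s) : 'I_s + 'I_s := match z with inl a => inr a | inr a => inl a end.
    apply: (@card_symLat_transport _ _ _ _ d2 d1 id sw); first by exists id.
      by move=> [a|a] [b|b] // [->].
    by case.
  have [f bf] : exists f : A -> 'I_s + 'I_s, bijective f.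
    by apply: eq_card_bijection; rewrite card_sum cs At.
  have [fi fK Kf] := bf.
  have cL : #|Lat A A B| <= #|Lat {: 'I_s + 'I_s} {: 'I_s + 'I_s} B|.
    apply: (@leq_card_inj _ _ (fun L : {ffun A * A -> B} =>
      [ffun p : ('I_s + 'I_s) * ('I_s + 'I_s) => L (fi p.1, fi p.2)])) =>
      [L L' _ _ /ffunP e|L /LatP[r c]].
      by apply/ffunP=> -[x y]; have := e (f x, f y); rewrite !ffunE /= !fK.
    have ifi := can_inj Kf.
    by apply/LatP; split=> [x y y'|y x x']; rewrite !ffunE /=; [move/r/ifi|move/c/ifi].
  apply: leq_trans (leq_mul (leq_mul (leqnn u) u2) cL) _.
  apply: leq_trans (card_symLat_block _ _ _) _.
  (* Both copies of a point of [A] go to the same block, so that its symbol occurs twice there. *)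
  pose F (z : A + A) : ('I_s + 'I_s) + ('I_s + 'I_s) :=
    match z with
    | inl a => match f a with inl c => inl (inl c) | inr c => inr (inl c) end
    | inr a => match f a with inl c => inl (inr c) | inr c => inr (inr c) end end.
  pose G (z : ('I_s + 'I_s) + B) : A + B := match z with inl c => inl (fi c) | inr b => inr b end.
  apply: (@card_symLat_transport _ _ _ _ _ _ F G).
  - apply: inj_card_bij; last by rewrite !card_sum cs At; lia.
    move=> [a|a] [b|b] /=; case fa: (f a) => [c|c]; case fb: (f b) => [c'|c'] // [e];
      by congr (_ _); apply: (bij_inj bf); rewrite fa fb e.
  - by move=> [a|a] [b|b] // [] => [/(can_inj Kf)|] ->.
  - by case=> a /=; case fa: (f a) => [c|c] /=; rewrite -fa fK.
have oA : odd #|A| by rewrite At.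
have := card_idempotent_ge oA; rewrite At => hI.
have le : #|symLat (@id A)| * #|symLat (@id A)| * #|Lat A A B| <= #|symLat (@half_diag A B)|.
  apply: leq_trans (card_symLat_block _ _ _) _.
  by apply: (@card_symLat_transport _ _ _ _ _ _ id id); [exists id | | case].
have [small|big] := leqP t 6; last first.
  apply: leq_trans (combine_bounds hI hL _) _; first by nia.
  by rewrite leq_mul2l le orbT.
apply: small_bound; first by lia.
apply: leq_trans le; rewrite muln_gt0.
have p0 : 0 < t ^ (t * t) by rewrite expn_gt0 t0.
have := leq_trans p0 hI; have := leq_trans p0 hL; rewrite !muln_gt0.
by move=> /andP[_ ->] /andP[_ ->].
Qed.

(** * Parallelisms from unipotent symmetric squares *)

Section Parallelisms.
Variables (n : nat) (s0 : 'I_n).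
Implicit Types (q : {ffun 'I_n * 'I_n -> 'I_n}) (c x y : 'I_n).
Let U : {set {ffun 'I_n * 'I_n -> 'I_n}} := symLat (fun _ : 'I_n => s0).

Definition color_class q c : {set {set 'I_n}} :=
  [set [set p.1; p.2] | p in [set p : 'I_n * 'I_n | q p == c]].
Definition color_classes q : {set {set {set 'I_n}}} := [set color_class q c | c in [set~ s0]].

Lemma color_class_pt q c e z : q \in U -> e \in color_class q c -> z \in e ->
  exists2 y, e = [set z; y] & q (z, y) = c.
Proof.
move=> /symLatP[s _ _] /imsetP [[x y]]; rewrite inE /= => /eqP qc ->; rewrite !inE.
by case/orP=> /eqP ->; [exists y | exists x; rewrite 1?setUC // s].
Qed.

Lemma mem_color_class q x y : [set x; y] \in color_class q (q (x, y)).
Proof. by apply/imsetP; exists (x, y); rewrite ?inE. Qed.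

Lemma color_classE q c x y : q \in U -> x != y -> [set x; y] \in color_class q c -> q (x, y) = c.
Proof.
move=> qU xy e; have [|y' exy <-] := color_class_pt (z := x) qU e; first by rewrite !inE eqxx.
have : y \in [set x; y'] by rewrite -exy !inE eqxx orbT.
by rewrite !inE eq_sym (negbTE xy) => /eqP ->.
Qed.

Lemma color_inverse q x c : q \in U -> exists y, q (x, y) = c.
Proof.
move=> /symLatP[_ r _]; have [g _ Kg] : bijective (fun y => q (x, y)).
  by apply: injF_bij => y y'; apply: r.
by exists (g c); rewrite Kg.
Qed.

Lemma color_neq q x y : q \in U -> (q (x, y) != s0) = (x != y).
Proof.
move=> /symLatP[_ r e]; congr (~~ _); apply/eqP/eqP => [|->//].
by rewrite -(e x) => /r.
Qed.

Lemma card_color_class q c e : q \in U -> c != s0 -> e \in color_class q c -> #|e| = 2.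
Proof.
move=> qU c0 /imsetP [[x y]]; rewrite inE /= => /eqP qc ->.
by rewrite cards2; move: c0; rewrite -qc color_neq // => ->.
Qed.

Lemma color_class_matching q c : q \in U -> c != s0 -> perfect_matching (color_class q c).
Proof.
move=> qU c0; apply/andP; split; last first.
  by apply/forall_inP=> e ec; rewrite (card_color_class qU c0 ec).
apply/and3P; split.
- apply/eqP/setP=> x; rewrite inE; apply/bigcupP.
  have [y xy] := color_inverse x c qU.
  by exists [set x; y]; [rewrite -xy mem_color_class | rewrite !inE eqxx].
- apply/trivIsetP=> e e' ec e'c; apply: contraR => /pred0Pn [z /= /andP[ze ze']].
  have [y -> qy] := color_class_pt qU ec ze.
  have [y' -> qy'] := color_class_pt qU e'c ze'.
  by have /symLatP[_ r _] := qU; rewrite (r z y y') // qy qy'.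
- by apply/negP=> /(card_color_class qU c0); rewrite cards0.
Qed.

Lemma color_classes_parallelism q : q \in U -> parallelism (color_classes q).
Proof.
move=> qU; apply/andP; split; last first.
  by apply/forall_inP=> C /imsetP [c]; rewrite !inE => c0 ->; apply: color_class_matching.
apply/and3P; split.
- apply/eqP/setP=> e; rewrite inE; apply/bigcupP/idP => [[C]|/cards2P [x [y [xy ->]]]].
    by case/imsetP=> c; rewrite !inE => c0 -> ec; rewrite (card_color_class qU c0 ec).
  exists (color_class q (q (x, y))); last exact: mem_color_class.
  by apply/imsetP; exists (q (x, y)); rewrite ?inE ?color_neq.
- apply/trivIsetP=> C C' /imsetP [c]; rewrite !inE => c0 -> /imsetP [c']; rewrite !inE => c0' ->.
  apply: contraR => /pred0Pn [e /= /andP[ec ec']].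
  have /eqP := card_color_class qU c0 ec; case/cards2P=> x [y [xy eE]]; subst e.
  by rewrite -(color_classE qU xy ec) (color_classE qU xy ec').
- apply/negP=> /imsetP [c]; rewrite !inE => c0 e0.
  have [y xy] := color_inverse s0 c qU.
  by have := mem_color_class q s0 y; rewrite xy -e0 inE.
Qed.

(** Passing to classes forgets their colours. The row of [s0] restores them, since each class has
    exactly one edge at [s0]. *)
Lemma card_Par_ge : #|U| <= n ^ n * #|Par n|.
Proof.
pose F q : {ffun 'I_n -> 'I_n} * {set {set {set 'I_n}}} :=
  ([ffun y => q (s0, y)], color_classes q).
have -> : n ^ n = #|[set: {ffun 'I_n -> 'I_n}]| by rewrite cardsT card_ffun card_ord.
rewrite -cardsX; apply: (@leq_card_inj _ _ F) => [q q' qU qU' [] /ffunP row cl|q qU]; last first.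
  by rewrite in_setX in_setT inE color_classes_parallelism.
apply/ffunP=> -[x y]; have [<-|xy] := eqVneq x y.
  by have /symLatP[_ _ ->] := qU; have /symLatP[_ _ ->] := qU'.
have : color_class q (q (x, y)) \in color_classes q'.
  by rewrite -cl; apply/imsetP; exists (q (x, y)); rewrite // !inE color_neq.
case/imsetP=> c'; rewrite !inE => c0' cE.
have [z qz] := color_inverse s0 (q (x, y)) qU.
have s0z : s0 != z by rewrite -(color_neq _ _ qU) qz color_neq.
have := mem_color_class q x y; rewrite cE => /(color_classE qU' xy) ->.
have := mem_color_class q s0 z; rewrite qz cE => /(color_classE qU' s0z) <-.
by have := row z; rewrite !ffunE qz.
Qed.

End Parallelisms.

(** * Steiner triple systems from three symmetric squares *)

Section SteinerOperations.
Variable P : finType.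

(** A Steiner quasigroup off its diagonal: [T x y] is the third point of the block of [x] and
    [y]. *)
Definition steiner_op (T : P -> P -> P) := forall x y, x != y ->
  [/\ T x y = T y x, T x y != x & T x (T x y) = y].

Definition op_blocks (T : P -> P -> P) : {set {set P}} :=
  [set [set p.1; p.2; T p.1 p.2] | p in [set p : P * P | p.1 != p.2]].

Lemma mem_op_blocks T x y : x != y -> [set x; y; T x y] \in op_blocks T.
Proof. by move=> xy; apply/imsetP; exists (x, y); rewrite ?inE. Qed.

Variable T : P -> P -> P.
Hypothesis sT : steiner_op T.

Lemma steiner_op_neq x y : x != y -> [/\ x != y, x != T x y & y != T x y].
Proof.
move=> xy; have yx : y != x by rewrite eq_sym.
have [c n1 _] := sT xy; have [_ n2 _] := sT yx.
by split=> //; [rewrite eq_sym | rewrite c eq_sym].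
Qed.

Lemma op_blocksE b x y : b \in op_blocks T -> x \in b -> y \in b -> x != y -> b = [set x; y; T x y].
Proof.
case/imsetP=> -[u v]; rewrite inE /= => uv ->.
have [_ uw vw] := steiner_op_neq uv.
have [c _ w1] := sT uv.
have vu : v != u by rewrite eq_sym.
have [c2 _ w2] := sT vu; rewrite -c in w2.
have [c3 _ _] := sT uw; have [c4 _ _] := sT vw.
rewrite !inE -!orbA => /or3P[] /eqP -> /or3P[] /eqP ->; rewrite ?eqxx // => _.
- by apply/setP=> z; rewrite w1 !inE -!orbA; case: (z == u); case: (z == v); case: (z == T u v).
- by apply/setP=> z; rewrite -c !inE -!orbA; case: (z == u); case: (z == v); case: (z == T u v).
- by apply/setP=> z; rewrite w2 !inE -!orbA; case: (z == u); case: (z == v); case: (z == T u v).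
- by apply/setP=> z; rewrite -c3 w1 !inE -!orbA; case: (z == u); case: (z == v); case: (z == T u v).
- by apply/setP=> z; rewrite -c4 w2 !inE -!orbA; case: (z == u); case: (z == v); case: (z == T u v).
Qed.

End SteinerOperations.

Lemma op_blocks_inj (P : finType) (T T' : P -> P -> P) : steiner_op T -> steiner_op T' ->
  op_blocks T = op_blocks T' -> forall x y, x != y -> T x y = T' x y.
Proof.
move=> sT sT' e x y xy; have := mem_op_blocks T xy; rewrite e => h.
have := op_blocksE sT' h (x := x) (y := y); rewrite !inE !eqxx orbT => /(_ isT isT xy)/setP.
have [_ n1 n2] := steiner_op_neq sT xy.
move/(_ (T x y)); rewrite !inE eqxx orbT (eq_sym _ x) (eq_sym _ y) (negbTE n1) (negbTE n2) /=.
by move/esym/eqP.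
Qed.

Lemma sts_op_blocks n (T : 'I_n -> 'I_n -> 'I_n) : steiner_op T -> sts (op_blocks T).
Proof.
move=> sT; apply/andP; split.
  apply/forall_inP=> b /imsetP [[x y]]; rewrite inE /= => xy ->.
  have [_ n1 n2] := steiner_op_neq sT xy.
  by rewrite setUC cardsU1 cards2 !inE negb_or xy ![T x y == _]eq_sym n1 n2.
apply/forallP=> x; apply/forallP=> y; apply/implyP=> xy; apply/cards1P.
exists [set x; y; T x y]; apply/setP=> b; rewrite [in RHS]inE.
apply/idP/eqP=> [|->]; last by rewrite inE mem_op_blocks // !inE !eqxx orbT.
by rewrite inE => /and3P[bB xb yb]; apply: op_blocksE.
Qed.

Lemma steiner_op_transport (P Q : finType) (T : P -> P -> P) (f : P -> Q) (g : Q -> P) :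
  cancel f g -> cancel g f -> steiner_op T -> steiner_op (fun x y => f (T (g x) (g y))).
Proof.
move=> fK gK sT x y xy; have gxy : g x != g y by rewrite (can_eq gK).
by have [c n1 h] := sT _ _ gxy; rewrite c fK -c h gK -(can_eq gK) fK.
Qed.

Section TripleSquares.
Variables (X W : finType) (d : X -> X).
Local Open Scope ring_scope.
Notation P := (X * 'I_3 + W)%type.

Lemma I3_next_neq (i : 'I_3) : (i + 1 == i) = false.
Proof. by case: i => [[|[|[|?]]]]. Qed.

Lemma I3_prev (i j : 'I_3) : (i == j) = false -> (j == i + 1) = false -> i = j + 1.
Proof. by move=> h h'; apply/eqP; move: i j h h'; do 2! case=> [[|[|[|?]]]] ?. Qed.

Lemma I3_antisym (i : 'I_3) : (i == i + 1 + 1) = false.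
Proof. by case: i => [[|[|[|?]]]]. Qed.

Lemma I3_third_neq (i j : 'I_3) : i != j -> - (i + j) != i.
Proof. by move: i j; do 2! case=> [[|[|[|?]]]] ?. Qed.

Lemma I3_third_next (i j : 'I_3) : i != j -> (- (i + j) == i + 1) || (i == - (i + j) + 1).
Proof. by move: i j; do 2! case=> [[|[|[|?]]]] ?. Qed.

Lemma I3_thirdK (i j : 'I_3) : - (i + - (i + j)) = j.
Proof. by rewrite opprD opprK addKr. Qed.

(** The pairs that the squares leave uncovered: since [q i (x, x) = d x], the points [(x, i)] and
    [(d x, i + 1)] share no block coming from distinct points of level [i]. These pairs, and all
    pairs meeting [W], are left to [sp]. *)
Definition special (p p' : P) : bool :=
  match p, p' with
  | inl (x, i), inl (y, j) => ((j == i + 1) && (y == d x)) || ((i == j + 1) && (x == d y))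
  | _, _ => true end.

Variable sp : P -> P -> P.
Hypothesis sp_op : forall p p', p != p' -> special p p' ->
  [/\ sp p p' = sp p' p, sp p p' != p, special p (sp p p') & sp p (sp p p') = p'].

Definition ldiv (q : {ffun X * X -> X}) x y := odflt x [pick z | q (x, z) == y].

Lemma ldivK q x y : q \in symLat d -> q (x, ldiv q x y) = y.
Proof.
move=> /symLatP[_ r _]; rewrite /ldiv; case: pickP => [z /eqP //|none].
have [g _ Kg] : bijective (fun z => q (x, z)) by apply: injF_bij => z z'; apply: r.
by have := none (g y); rewrite Kg eqxx.
Qed.

Lemma ldivE q x y z : q \in symLat d -> q (x, z) = y -> ldiv q x y = z.
Proof. by move=> qS e; have /symLatP[_ r _] := qS; apply: (r x); rewrite ldivK. Qed.

(** The squares give the blocks [(x, i)], [(y, i)], [(q i (x, y), i + 1)] with [x != y]; [ldiv]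
    recovers one of the two points of level [i] from the rest. *)
Definition triple_op (q : {ffun 'I_3 -> {ffun X * X -> X}}) (p p' : P) : P :=
  match p, p' with
  | inl (x, i), inl (y, j) =>
    if special p p' then sp p p'
    else if i == j then inl (q i (x, y), i + 1)
    else if j == i + 1 then inl (ldiv (q i) x y, i)
    else inl (ldiv (q j) y x, j)
  | _, _ => sp p p' end.

Lemma triple_op_special q p p' : special p p' -> triple_op q p p' = sp p p'.
Proof. by case: p p' => [[x i]|w] [[y j]|w'] //= ->. Qed.

Lemma triple_op_steiner (q : {ffun 'I_3 -> {ffun X * X -> X}}) :
  (forall i, q i \in symLat d) -> steiner_op (triple_op q).
Proof.
move=> qS p p' pp; have [spec|] := boolP (special p p').
  have [c n1 s h] := sp_op pp spec.
  have spec' : special p' p.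
    by move: spec; case: (p) (p') => [[x i]|w] [[y j]|w'] //=; rewrite orbC.
  by rewrite !triple_op_special.
case: p p' pp => [[x i]|w] [[y j]|w'] // pp /negbTE nspec.
have s i' : _ := let: And3 s _ _ := symLatP _ _ (qS i') in s.
have r i' : _ := let: And3 _ r _ := symLatP _ _ (qS i') in r.
have e i' : _ := let: And3 _ _ e := symLatP _ _ (qS i') in e.
have nspec' : special (inl (y, j)) (inl (x, i)) = false by rewrite -nspec /= orbC.
rewrite /triple_op nspec nspec' (eq_sym j i).
have [ij|nij] := eqVneq i j.
  subst j; have xy : x != y by apply: contraNneq pp => ->.
  rewrite s; split=> //.
    by rewrite (inj_eq inl_inj) xpair_eqE I3_next_neq andbF.
  have -> : special (inl (x, i)) (inl (q i (y, x), i + 1)) = false.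
    rewrite /= eqxx I3_antisym orbF /= -(e i) [q i (y, x)]s.
    by apply/negP=> /eqP/r yx; rewrite yx eqxx in xy.
  by rewrite eq_sym I3_next_neq eqxx (ldivE (qS i) (s i x y)).
have nji : (j == i) = false by rewrite eq_sym (negbTE nij).
have [ji|nji1] := eqVneq j (i + 1).
  subst j; rewrite (I3_antisym i).
  have nyx : (y == d x) = false by move: nspec; rewrite /= eqxx I3_antisym orbF.
  have zE := ldivK x y (qS i); set z := ldiv (q i) x y in zE *.
  have zx : z != x by apply/eqP=> zx; rewrite zx e in zE; rewrite zE eqxx in nyx.
  split=> //; first by rewrite (inj_eq inl_inj) xpair_eqE (negbTE zx).
  have -> : special (inl (x, i)) (inl (z, i)) = false by rewrite /= eq_sym I3_next_neq.
  by rewrite eqxx zE.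
have {nji1} ij := I3_prev (negbTE nij) (negbTE nji1); subst i; rewrite eqxx.
have nxy : (x == d y) = false by move: nspec; rewrite /= eqxx I3_antisym.
have zE := ldivK y x (qS j); set z := ldiv (q j) y x in zE *.
split=> //; first by rewrite (inj_eq inl_inj) xpair_eqE (eq_sym j) I3_next_neq andbF.
have -> : special (inl (x, j + 1)) (inl (z, j)) = false.
  rewrite /= I3_antisym eqxx /= -(e j) -zE s.
  by apply/negP=> /eqP/r yz; rewrite yz e in zE; rewrite yz zE eqxx in nxy.
by rewrite I3_next_neq I3_antisym (ldivE (qS j) (z := y)) // s.
Qed.

(** The three squares are chosen independently, and each is read off from the pairs within its
    level. *)
Lemma card_STS_ge n : #|{: P}| = n -> (#|symLat d| ^ 3 <= #|STS n|)%N.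
Proof.
move=> Pn; have [f bf] : exists f : P -> 'I_n, bijective f.
  by apply: eq_card_bijection; rewrite card_ord.
have [g fK gK] := bf.
pose op q x y := f (triple_op q (g x) (g y)).
have opS (q : {ffun 'I_3 -> {ffun X * X -> X}}) : (forall i, q i \in symLat d) -> steiner_op (op q).
  by move=> qS; apply: steiner_op_transport fK gK _; apply: triple_op_steiner.
rewrite -[X in (_ ^ X)%N](card_ord 3) -card_ffun_on.
apply: (@leq_card_inj _ _ (fun q => op_blocks (op q))) => [q q'|q] /ffun_onP qS; last first.
  by rewrite inE sts_op_blocks //; apply: opS.
move=> /ffun_onP qS' eqB; apply/ffunP=> i; apply/ffunP=> -[x y].
have [->|xy] := eqVneq x y.
  by have /symLatP[_ _ ->] := qS i; have /symLatP[_ _ ->] := qS' i.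
have ne : f (inl (x, i)) != f (inl (y, i)).
  by rewrite (can_eq fK) (inj_eq inl_inj) xpair_eqE eqxx andbT.
have := op_blocks_inj (opS _ qS) (opS _ qS') eqB ne; rewrite /op !fK => /(can_inj fK).
rewrite /triple_op.
have -> : special (inl (x, i)) (inl (y, i)) = false by rewrite /= eq_sym I3_next_neq.
by rewrite eqxx => -[].
Qed.

End TripleSquares.

(** For the diagonal [id], the special pairs above [x] form one block through the three levels;
    [- (i + j)] is the third level because all three sum to 0 modulo 3. *)
Lemma card_STS_bose (X : finType) n : (#|X| * 3 = n)%N -> (#|symLat (@id X)| ^ 3 <= #|STS n|)%N.
Proof.
move=> Xn.
pose sp (p p' : (X * 'I_3 + void)%type) : (X * 'I_3 + void)%type := match p, p' with
  | inl (x, i), inl (y, j) => inl (x, (- (i + j))%R) | _, _ => p end.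
apply: (@card_STS_ge _ void _ sp); last by rewrite card_sum card_prod card_ord card_void addn0.
move=> [[x i]|//] [[y j]|//] pp h.
have [yx ij] : y = x /\ i != j.
  move: h => /= /orP[] /andP[/eqP -> /eqP <-]; split=> //.
    by rewrite eq_sym I3_next_neq.
  by rewrite I3_next_neq.
subst y; clear pp h; rewrite /sp /special; split.
- by rewrite addrC.
- by rewrite (inj_eq inl_inj) xpair_eqE eqxx I3_third_neq.
- by rewrite eqxx !andbT I3_third_next.
- by rewrite I3_thirdK.
Qed.

(** The points above [inl a] again form a block, while [(inr a, i)] lacks only [(inl a, i + 1)], and
    the point at infinity [inr tt] completes that pair. *)
Lemma card_STS_skolem (A : finType) n : (#|A| * 6).+1 = n ->
  (#|symLat (@half_diag A A)| ^ 3 <= #|STS n|)%N.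
Proof.
move=> An.
pose sp (p p' : ((A + A) * 'I_3 + unit)%type) : ((A + A) * 'I_3 + unit)%type := match p, p' with
  | inr _, inl (inl a, i) | inl (inl a, i), inr _ => inl (inr a, (i - 1)%R)
  | inr _, inl (inr a, i) | inl (inr a, i), inr _ => inl (inl a, (i + 1)%R)
  | inl (inl a, i), inl (inl b, j) => inl (inl a, (- (i + j))%R)
  | _, _ => inr tt end.
apply: (@card_STS_ge _ unit _ sp); last first.
  by rewrite !card_sum card_prod card_sum card_ord card_unit; lia.
have inl_eq (u v : (A + A) * 'I_3) : ((inl u : (A + A) * 'I_3 + unit) == inl v) = (u == v).
  exact: (inj_eq inl_inj).
have a3 (i : 'I_3) : (i - 1 + 1 = i)%R by rewrite subrK.
have b3 (i : 'I_3) : (i + 1 - 1 = i)%R by rewrite addrK.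
case=> [[[a|a] i]|[]] [[[b|b] j]|[]] //= pp.
- move=> h; have [ba ij] : b = a /\ i != j.
    move: h => /orP[] /andP[/eqP -> /eqP [<-]]; split=> //.
      by rewrite eq_sym I3_next_neq.
    by rewrite I3_next_neq.
  subst b; clear pp h; split.
  + by rewrite addrC.
  + by rewrite inl_eq xpair_eqE eqxx I3_third_neq.
  + by rewrite eqxx !andbT I3_third_next.
  + by rewrite I3_thirdK.
- by rewrite andbF /= => /andP[/eqP -> /eqP[->]]; rewrite addrK.
- by move=> _; rewrite !eqxx a3 eqxx /= ?orbT.
- by rewrite andbF orbF => /andP[/eqP -> /eqP[->]].
- by rewrite !andbF.
- by move=> _; rewrite !eqxx.
- by move=> _; rewrite a3.
- by move=> _; rewrite b3.
Qed.

(** * Objects with a prescribed automorphism *)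

Lemma perm_neq1 (T : finType) (p : {perm T}) : p != 1%g -> exists z, p z != z.
Proof.
move=> p1; apply/existsP; apply: contraNT p1; rewrite negb_exists => /forallP h.
by apply/eqP/permP=> x; rewrite perm1; apply/eqP; have := h x; rewrite negbK.
Qed.

Lemma leq_card_cover (T I : finType) (A : {set T}) (B : I -> {set T}) m :
  (forall x, x \in A -> exists i, x \in B i) -> (forall i, #|B i| <= m) -> #|A| <= #|I| * m.
Proof.
move=> AB Bm; rewrite -sum_nat_const -sum1_card.
apply: (@leq_trans (\sum_i \sum_(x in B i) 1)); last first.
  by apply: leq_sum => i _; rewrite sum1_card.
rewrite (exchange_big_dep xpredT) //= big_mkcond /=; apply: leq_sum => x _.
by case: ifP => // /AB [i xi]; rewrite (bigD1 i).
Qed.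

(** * Encoding invariant structures by answers to queries *)

Section Encoding.
Variables (Cell Q : finType) (Qs : {set Q}) (cov : Q -> {set Cell}) (g : {perm Cell}) (n : nat).
Variable F : {set {set Cell}}.
Hypotheses (n_gt0 : 0 < n) (cov_le : forall q, q \in Qs -> #|cov q| <= n).
Hypothesis covered : forall L q, L \in F -> q \in Qs -> exists2 x, x \in L & x \in cov q.
Hypothesis cov_uniq : forall L x, L \in F -> x \in L ->
  exists2 q, q \in Qs & forall y, y \in L -> y \in cov q -> y = x.
Hypothesis inv : forall L x, L \in F -> x \in L -> g x \in L.

(** Fixed cells count twice, so every orbit weighs at least 2 and half the weight of an invariant
    set bounds its number of orbits. *)
Definition orbit_weight (A : {set Cell}) := #|A| + #|[set x in A | g x == x]|.

Lemma orbit_weight_setU (A B : {set Cell}) : [disjoint A & B] ->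
  orbit_weight (A :|: B) = orbit_weight A + orbit_weight B.
Proof.
move=> dAB; rewrite /orbit_weight addnACA; congr (_ + _).
  by apply/eqP; rewrite (leq_card_setU A B).
have -> : [set x in A :|: B | g x == x] = [set x in A | g x == x] :|: [set x in B | g x == x].
  by apply/setP=> x; rewrite !inE andb_orl.
apply/eqP; rewrite (leq_card_setU _ _); apply: disjointWl (disjointWr _ dAB).
  by apply/subsetP=> x; rewrite inE => /andP[].
by apply/subsetP=> x; rewrite inE => /andP[].
Qed.

Lemma orbit_weight_porbit x : 2 <= orbit_weight (porbit g x).
Proof.
have xx : x \in porbit g x by apply: porbit_id.
have [gx|gx] := eqVneq (g x) x.
  apply: (@leq_add 1 1); apply/card_gt0P; exists x => //.
  by rewrite inE xx gx eqxx.
apply: leq_trans (leq_addr _ _).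
have : [set x; g x] \subset porbit g x.
  by apply/subsetP=> y; rewrite !inE => /orP[] /eqP ->; rewrite // -{1}[g]expg1 mem_porbit.
by move/subset_leq_card; rewrite cards2 eq_sym gx.
Qed.

Definition extensions (A : {set Cell}) k :=
  [set L in F | (A \subset L) && (orbit_weight (L :\: A) <= k.*2)].

(** Once [A] answers every query nothing can be added: a further cell would answer some query a
    second time. *)
Lemma card_extensions_covered (A : {set Cell}) k :
  (forall q, q \in Qs -> exists2 y, y \in A & y \in cov q) ->
  #|extensions A k| <= n ^ k.
Proof.
move=> cA; apply: (@leq_trans #|[set A]|); last by rewrite cards1 expn_gt0 n_gt0.
apply: subset_leq_card; apply/subsetP=> L; rewrite !inE => /and3P[LF AL _].
rewrite eqEsubset AL andbT; apply/subsetP=> x xL.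
have [q qQ uq] := cov_uniq LF xL; have [y yA yq] := cA q qQ.
by rewrite -(uq y) // (subsetP AL).
Qed.

Lemma porbit_sub (L : {set Cell}) x : L \in F -> x \in L -> porbit g x \subset L.
Proof.
move=> LF xL; apply/subsetP=> y /porbitP [i ->]; elim: i => [|i IH]; first by rewrite expg0 perm1.
by rewrite expgSr permM; apply: inv.
Qed.

(* Asking for the cell of an uncovered query has at most [n] answers, and each answer
   reveals a whole orbit, of weight at least two. *)
Lemma card_extensions k (A : {set Cell}) : (forall x, (g x \in A) = (x \in A)) ->
  #|extensions A k| <= n ^ k.
Proof.
elim: k A => [|k IH] A Ainv.
all: have [/exists_inP [q qQ /pred0P qA]|cov_all] :=
  boolP [exists q in Qs, [disjoint A & cov q]]; last first.
all: try by apply: card_extensions_covered => q qQ; move/exists_inPn: cov_all => /(_ q qQ);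
  case/pred0Pn=> y /= /andP[yA yq]; exists y.
all: have new L : L \in F -> exists2 x, x \in L :\: A & x \in cov q by
  move=> LF; have [x xL xq] := covered LF qQ; exists x => //; rewrite inE xL andbT;
  apply/negP=> xA; have := qA x; rewrite /= xA xq.
- rewrite (_ : extensions A 0 = set0) ?cards0 //.
  apply/setP=> L; rewrite !inE; apply/and3P=> -[LF AL].
  rewrite leqn0 addn_eq0 cards_eq0 => /andP[/eqP L0 _].
  by have [x] := new L LF; rewrite L0 inE.
apply: (@leq_trans (\sum_(x in cov q) n ^ k)); last first.
  by rewrite sum_nat_const expnS leq_mul2r cov_le ?orbT.
apply: (@leq_trans (\sum_(x in cov q | x \notin A) #|extensions (A :|: porbit g x) k|)); last first.
  rewrite big_mkcondr; apply: leq_sum => x _; case: ifP => // xA; apply: IH => y.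
  rewrite !inE Ainv; congr (_ || _).
  by rewrite -!eq_porbit_mem -{1}[g y]/((g ^+ 1)%g y) porbit_perm.
rewrite -sum1_card.
apply: (@leq_trans (\sum_(x in cov q | x \notin A) \sum_(L in extensions (A :|: porbit g x) k) 1));
  last by apply: leq_sum => x _; rewrite sum1_card.
rewrite (exchange_big_dep xpredT) //= big_mkcond /=; apply: leq_sum => L _.
case: ifP => //; rewrite inE => /and3P[LF AL wL].
have [x] := new L LF; rewrite inE => /andP[xA xL] xq.
have oL := porbit_sub LF xL.
have dis : [disjoint A & porbit g x].
  rewrite disjoint_sym; apply/pred0P=> y /=; apply/negP=> /andP[/porbitP [i ->]].
  elim: i => [|i IHi]; first by rewrite expg0 perm1 (negbTE xA).
  by rewrite expgSr permM Ainv.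
rewrite (bigD1 x) ?xq //=.
rewrite xA inE LF subUset AL oL /=.
have eL : L :\: A = (L :\: (A :|: porbit g x)) :|: porbit g x.
  apply/setP=> y; rewrite !inE; case yo: (y \in porbit g x); rewrite ?orbT ?orbF ?andbF //=.
  rewrite (subsetP oL) // andbT; apply/negP=> yA.
  by move/pred0P/(_ y): dis; rewrite /= yA yo.
move: wL; rewrite eL orbit_weight_setU.
  by have := orbit_weight_porbit x; rewrite doubleS; lia.
by apply/pred0P=> y; rewrite /= !inE; case: (y \in porbit g x); rewrite ?orbT ?andbF.
Qed.

Lemma card_encode k : (forall L, L \in F -> orbit_weight L <= k.*2) -> #|F| <= n ^ k.
Proof.
move=> wF; have inv0 x : (g x \in set0) = (x \in set0) by rewrite !inE.
apply: leq_trans (card_extensions k inv0); apply: subset_leq_card; apply/subsetP=> L LF.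
by rewrite inE LF sub0set setD0 wF.
Qed.

End Encoding.

Lemma I3_cases (k : 'I_3) : [\/ k = ord0, k = inord 1 | k = inord 2].
Proof.
case: k => [[|[|[|//]]] lt]; [constructor 1 | constructor 2 | constructor 3];
  by apply: ord_inj; rewrite ?inordK.
Qed.

Lemma I3_other (k k' : 'I_3) : k' != k -> exists k'', [/\ k'' != k, k'' != k' &
  forall l, [\/ l = k, l = k' | l = k'']].
Proof.
move=> kk; exists (- (k + k'))%R.
have [/eqP h1 /eqP h2] : (- (k + k'))%R != k /\ (- (k + k'))%R != k'.
  by move: k k' kk; do 2! case=> [[|[|[|?]]]] ?.
split; try exact/eqP.
move=> l; have : [|| l == k, l == k' | l == - (k + k')]%R.
  by move: k k' l kk h1 h2; do 3! case=> [[|[|[|?]]]] ?.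
by case/or3P=> /eqP; [constructor 1 | constructor 2 | constructor 3].
Qed.

(** * Latin squares with a prescribed automorphism *)

Section Latin.
Variables (n : nat).
Implicit Types (L : {ffun 'I_n * 'I_n -> 'I_n}) (t : {ffun 'I_3 -> 'I_n}) (k : 'I_3).

Definition cell_of L (p : 'I_n * 'I_n) : {ffun 'I_3 -> 'I_n} :=
  [ffun k : 'I_3 => if k == ord0 then p.1 else if k == inord 1 then p.2 else L p].

Lemma cell_ofE L p : [/\ cell_of L p ord0 = p.1, cell_of L p (inord 1) = p.2 &
  cell_of L p (inord 2) = L p].
Proof. by rewrite !ffunE -!val_eqE /= !inordK. Qed.

Lemma cell_of_cells L p : cell_of L p \in cells L.
Proof. by rewrite inE; have [-> -> ->] := cell_ofE L p; rewrite -surjective_pairing. Qed.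

Lemma cells_eq L t t' : t \in cells L -> t' \in cells L ->
  t ord0 = t' ord0 -> t (inord 1) = t' (inord 1) -> t = t'.
Proof.
rewrite !inE => /eqP e /eqP e' e0 e1; apply/ffunP=> k.
by case: (I3_cases k) => ->; rewrite // -e -e' e0 e1.
Qed.

Lemma cells_inj : injective (@cells n).
Proof.
move=> L L' e; apply/ffunP=> p.
have := cell_of_cells L p; rewrite e inE.
by have [-> -> ->] := cell_ofE L p; rewrite -surjective_pairing => /eqP.
Qed.

Lemma card_cells L : #|cells L| = n * n.
Proof.
have -> : n * n = #|{: 'I_n * 'I_n}| by rewrite card_prod card_ord.
apply/eqP; rewrite eqn_leq; apply/andP; split.
  apply: (@leq_card_in _ _ (fun t => (t ord0, t (inord 1)))) => t t' tL tL' [].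
  exact: cells_eq tL tL'.
rewrite -[X in X <= _]cardsT; apply: (@leq_card_inj _ _ (cell_of L)) => [p p' _ _ e|p _]; last first.
  exact: cell_of_cells.
have [e0 e1 _] := cell_ofE L p; have [e0' e1' _] := cell_ofE L p'.
by rewrite [p]surjective_pairing [p']surjective_pairing -e0 -e1 e e0' e1'.
Qed.

Lemma mapcell_inj s (f : {ffun 'I_3 -> {perm 'I_n}}) : injective (mapcell s f).
Proof.
move=> t t' /ffunP e; apply/ffunP=> k; have := e (s k).
by rewrite !ffunE permK => /perm_inj.
Qed.

Section Fixed.
Variables (L : {ffun 'I_n * 'I_n -> 'I_n}) (s : {perm 'I_3}) (f : {ffun 'I_3 -> {perm 'I_n}}).
Hypotheses (latL : latin L) (autL : latin_aut L s f).

Lemma cells_two t t' k k' : t \in cells L -> t' \in cells L -> k != k' ->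
  t k = t' k -> t k' = t' k' -> t = t'.
Proof.
move=> tL tL'; have := latL => /andP[/forallP r /forallP c].
have [e e'] : L (t ord0, t (inord 1)) = t (inord 2) /\ L (t' ord0, t' (inord 1)) = t' (inord 2).
  by move: tL tL'; rewrite !inE => /eqP -> /eqP ->.
have row : t ord0 = t' ord0 -> t (inord 2) = t' (inord 2) -> t = t'.
  move=> e0 e2; apply: (cells_eq tL tL' e0).
  by apply: (injectiveP _ (r (t ord0))); rewrite e e2 -e' e0.
have col : t (inord 1) = t' (inord 1) -> t (inord 2) = t' (inord 2) -> t = t'.
  move=> e1 e2; apply: (cells_eq tL tL' _ e1).
  by apply: (injectiveP _ (c (t (inord 1)))); rewrite e e2 -e' e1.
have base := cells_eq tL tL'.
by case: (I3_cases k) => ->; case: (I3_cases k') => ->; rewrite ?eqxx // => _ *; auto.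
Qed.

Lemma cells_exists k k' u v : k != k' -> exists2 t, t \in cells L & t k = u /\ t k' = v.
Proof.
move=> kk; pose P (t : {ffun 'I_3 -> 'I_n}) := (t k, t k').
have inj : {in cells L &, injective P} by move=> t t' tL tL' [] /cells_two; apply.
have : P @: cells L = setT.
  apply/eqP; rewrite eqEcard subsetT (card_in_imset inj) card_cells cardsT card_prod card_ord.
  exact: leqnn.
by move/setP/(_ (u, v)); rewrite in_setT => /imsetP [t tL [-> ->]]; exists t.
Qed.

Lemma mapcell_cells t : t \in cells L -> mapcell s f t \in cells L.
Proof. by move=> tL; rewrite -(eqP autL) imset_f. Qed.

Lemma fixed_cellE t k : mapcell s f t = t -> t (s k) = f k (t k).
Proof. by move=> /ffunP/(_ (s k)); rewrite ffunE permK. Qed.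

(** For [s = 1] and [z] moved by [f k], a cell with [z] at [k] and a fixed point at [k'] has a moved
    point at the third place, since two coordinates determine a cell. So the fixed points at the two
    other places total at most [n], and their product is at most [n^2 / 4]. *)
Lemma card_fixed_cells : (s != 1%g) || [exists l, f l != 1%g] ->
  4 * #|[set t in cells L | mapcell s f t == t]| <= n * n + 4 * n.
Proof.
have [s1 /= /existsP [k fk]|s1 _] := eqVneq s 1%g; last first.
  have [k sk] := perm_neq1 s1.
  (* A fixed cell satisfies [t (s k) = f k (t k)], so [t k] alone determines it. *)
  apply: leq_trans (leq_addl _ _); rewrite leq_mul2l /= -[X in _ <= X]card_ord.
  apply: (@leq_card_in _ _ (fun t => t k)) => t t'; rewrite !inE.
  move=> /andP[tL /eqP ft] /andP[tL' /eqP ft'] e.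
  apply: (cells_two (k := k) (k' := s k)); rewrite ?inE // 1?eq_sym //.
  by rewrite (fixed_cellE k ft) (fixed_cellE k ft') e.
have [z fz] := perm_neq1 fk.
have [k' kk'] : exists k', k' != k.
  by exists (k + 1)%R; move: (k); case=> [[|[|[|?]]]].
have [k'' [kk'' kk''' all3]] := I3_other kk'.
have mapE t l : mapcell s f t l = f l (t l) by rewrite ffunE s1 invg1 perm1.
pose A l := [set x | f l x == x].
have AA : #|A k'| + #|A k''| <= n.
  have [T hT] : exists T : 'I_n -> {ffun 'I_3 -> 'I_n}, forall y,
      [/\ T y \in cells L, T y k = z & T y k' = y].
    apply: (@fin_all_exists _ _ (fun y (t : {ffun 'I_3 -> 'I_n}) =>
      [/\ t \in cells L, t k = z & t k' = y])) => y; have [|t tL [tk tk']] := @cells_exists k k' z y.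
      by rewrite eq_sym.
    by exists t.
  have inj : {in A k' &, injective (fun y => T y k'')}.
    move=> y y' _ _ e; have [yL yk yk'] := hT y; have [yL' yk2 yk2'] := hT y'.
    have eT : T y = T y' by apply: (cells_two yL yL' kk'' e); rewrite yk yk2.
    by rewrite eT yk2' in yk'.
  rewrite -(card_in_imset inj) -[X in _ <= X](card_ord n) -cardsUI.
  rewrite (_ : _ :&: _ = set0) ?cards0 ?addn0 ?max_card //.
  apply/setP=> w; rewrite !inE; apply/negP=> /andP[/imsetP [y]]; rewrite inE => /eqP fy -> /eqP fw.
  have [yL yk yk'] := hT y.
  have := cells_two (mapcell_cells yL) yL kk'''; rewrite !mapE yk' => /(_ fw fy) e.
  by have := mapE (T y) k; rewrite e yk => e'; rewrite -e' eqxx in fz.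
have le : #|[set t in cells L | mapcell s f t == t]| <= #|A k'| * #|A k''|.
  rewrite -cardsX; apply: (@leq_card_inj _ _ (fun t => (t k', t k''))).
    move=> t t'; rewrite !inE => /andP[tL _] /andP[tL' _] [e e'].
    by apply: (cells_two (k := k'') (k' := k')); rewrite ?inE.
  move=> t; rewrite !inE => /andP[_ /eqP /ffunP ft].
  by have := ft k'; have := ft k''; rewrite !mapE => -> ->; rewrite !eqxx.
apply: leq_trans (leq_addr _ _); apply: leq_trans (leq_mul AA AA).
by apply: leq_trans (leq_mul (leqnn 4) le) _; rewrite mulnn nat_AGM2.
Qed.

End Fixed.

(** The condition on [k] is half the weight of [n^2] cells, at most [n^2 / 4 + n] of them fixed. *)
Lemma card_latin_aut_le (s : {perm 'I_3}) (f : {ffun 'I_3 -> {perm 'I_n}}) (k : nat) :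
  0 < n -> (s != 1%g) || [exists l, f l != 1%g] ->
  5 * (n * n) + 4 * n <= 8 * k ->
  #|[set L : {ffun 'I_n * 'I_n -> 'I_n} | latin L && latin_aut L s f]| <= n ^ k.
Proof.
move=> n0 nt hk; rewrite -(card_imset _ cells_inj).
set F := [set cells _ | _ in _].
have FP (C : {set {ffun 'I_3 -> 'I_n}}) : C \in F ->
    exists L, [/\ C = cells L, latin L & latin_aut L s f].
  by case/imsetP=> L; rewrite inE => /andP[? ?] ->; exists L.
pose cov (q : 'I_n * 'I_n) := [set t : {ffun 'I_3 -> 'I_n} | (t ord0, t (inord 1)) == q].
apply: (@card_encode _ _ setT cov (perm (@mapcell_inj s f))) => //.
- move=> q _; rewrite -[X in _ <= X]card_ord.
  apply: (@leq_card_in _ _ (fun t => t (inord 2))) => t t'; rewrite !inE => /eqP <- /eqP[e0 e1] e2.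
  by apply/ffunP=> l; case: (I3_cases l) => ->.
- move=> C q /FP [L [-> latL aL]] _; exists (cell_of L q); first exact: cell_of_cells.
  by rewrite inE; have [-> -> _] := cell_ofE L q; rewrite -surjective_pairing.
- move=> C t /FP [L [-> latL aL]] tL; exists (t ord0, t (inord 1)) => // t' tL'.
  by rewrite inE => /eqP [e0 e1]; apply: cells_eq tL' tL e0 e1.
- by move=> C t /FP [L [-> latL aL]] tL; rewrite permE mapcell_cells.
move=> C /FP [L [-> latL aL]]; rewrite /orbit_weight card_cells.
have := card_fixed_cells latL aL nt.
rewrite (eq_card (B := [set t in cells L | perm (@mapcell_inj s f) t == t])); last first.
  by move=> t; rewrite !inE permE.
by move: #|_| => w; rewrite -mul2n; lia.
Qed.

Lemma card_LatinSquaresStar_le (k : nat) : 0 < n -> 5 * (n * n) + 4 * n <= 8 * k ->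
  #|LatinSquaresStar n| <= 6 * (n`! ^ 3) * n ^ k.
Proof.
move=> n0 hk.
pose B (sf : {perm 'I_3} * {ffun 'I_3 -> {perm 'I_n}}) :=
  if (sf.1 != 1%g) || [exists k, sf.2 k != 1%g] then
    [set L : {ffun 'I_n * 'I_n -> 'I_n} | latin L && latin_aut L sf.1 sf.2] else set0.
have -> : 6 * n`! ^ 3 = #|{: {perm 'I_3} * {ffun 'I_3 -> {perm 'I_n}}}|.
  by rewrite card_prod card_ffun !card_Sn card_ord.
apply: (@leq_card_cover _ _ _ B) => [L|sf].
  rewrite inE => /andP[latL /existsP [s /existsP [f /andP[a nt]]]].
  by exists (s, f); rewrite /B nt inE latL a.
by rewrite /B; case: ifP => [nt|_]; rewrite ?cards0 // card_latin_aut_le.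
Qed.

End Latin.

(** * Steiner triple systems with a prescribed automorphism *)

Lemma card3_third (T : finType) (b : {set T}) x y : #|b| = 3 -> x \in b -> y \in b -> x != y ->
  exists w, [/\ b = [set x; y; w], w != x & w != y].
Proof.
move=> b3 xb yb xy; have : #|b :\ x :\ y| == 1.
  move/eqP: b3; rewrite (cardsD1 x) xb (cardsD1 y) in_setD1 (eq_sym y x) xy yb /= !add1n.
  by rewrite !eqSS.
case/cards1P=> w /setP e; exists w; have := e w; rewrite !inE eqxx => /and3P[wy wx wb].
split=> //; apply/setP=> z; have := e z; rewrite !inE.
by case: (eqVneq z y) => [->|_]; rewrite ?orbT ?yb //; case: (eqVneq z x) => [->|_].
Qed.

Definition pairs_of (T : finType) (b : {set T}) : {set T * T} :=
  [set q | (q.1 \in b) && (q.2 \in b :\ q.1)].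

Lemma card_pairs_of (T : finType) (b : {set T}) : #|pairs_of b| = #|b| * #|b|.-1.
Proof.
rewrite [LHS](card_sigma_set b (fun x => b :\ x)) -sum_nat_const; apply: eq_bigr => x xb.
by rewrite (cardsD1 x b) xb.
Qed.

Lemma imset_perm_inj (T : finType) (p : {perm T}) : injective (fun b : {set T} => p @: b).
Proof. exact: imset_inj (@perm_inj T p). Qed.

Section FixedPoints.
Variables (T : finType) (p : {perm T}).

Definition fixpts := [set x | p x == x].

Lemma double_card_fixpts (f : T -> T) : {in fixpts &, injective f} ->
  (forall y, y \in fixpts -> f y \notin fixpts) -> #|fixpts| + #|fixpts| <= #|T|.
Proof.
move=> inj out; rewrite -{2}(card_in_imset inj) -cardsUI.
rewrite (_ : _ :&: _ = set0) ?cards0 ?addn0 ?max_card //.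
apply/setP=> w; rewrite inE [RHS]inE; apply/andP=> -[wF /imsetP [y yF e]].
by have := out y yF; rewrite -e wF.
Qed.

Lemma fixed_set_cases (b : {set T}) : p @: b = b ->
  (b \subset fixpts) || [exists z in b, (p z != z) && (p z \in b)].
Proof.
move=> e; have [//|/subsetPn [z zb]] := boolP (b \subset fixpts); rewrite inE => pz.
by apply/exists_inP; exists z; rewrite // pz -e imset_f.
Qed.

End FixedPoints.

Section STS.
Variable n : nat.
Implicit Types (b : {set 'I_n}) (B : {set {set 'I_n}}) (p : {perm 'I_n}).

Lemma sts_card B b : sts B -> b \in B -> #|b| = 3.
Proof. by move=> /andP[/forall_inP h _] /h/eqP. Qed.

Lemma sts_exists B x y : sts B -> x != y -> exists b, [/\ b \in B, x \in b & y \in b].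
Proof.
move=> /andP[_ /forallP/(_ x)/forallP/(_ y)/implyP h] /h /cards1P [b /setP/(_ b)].
by rewrite !inE eqxx => /and3P[]; exists b.
Qed.

Lemma sts_uniq B x y b b' : sts B -> x != y -> b \in B -> b' \in B ->
  x \in b -> y \in b -> x \in b' -> y \in b' -> b = b'.
Proof.
move=> /andP[_ /forallP/(_ x)/forallP/(_ y)/implyP h] /h /cards1P [c /setP e] bB bB' xb yb xb' yb'.
have := e b; rewrite !inE bB xb yb => /esym/eqP ->.
by have := e b'; rewrite !inE bB' xb' yb' => /esym/eqP ->.
Qed.

Lemma sts_third B x y : sts B -> x != y -> exists w, [/\ [set x; y; w] \in B, w != x & w != y].
Proof.
move=> sB xy; have [b [bB xb yb]] := sts_exists sB xy.
have [w [bE wx wy]] := card3_third (sts_card sB bB) xb yb xy.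
by exists w; rewrite -bE.
Qed.

Section Fixed.
Variables (B : {set {set 'I_n}}) (p : {perm 'I_n}).
Hypotheses (sB : sts B) (aB : sts_aut B p).

Lemma sts_aut_mem b : b \in B -> p @: b \in B.
Proof. by move=> bB; rewrite -(eqP aB); apply: imset_f. Qed.

(** Each block holds six ordered pairs of distinct points, and no pair lies in two blocks. *)
Lemma sts_card_pairs (C : {set {set 'I_n}}) (S : {set 'I_n}) :
  C \subset B -> (forall b, b \in C -> b \subset S) -> 6 * #|C| <= #|S| * #|S|.
Proof.
move=> CB CS; rewrite mulnC -sum_nat_const -cardsX.
rewrite (eq_bigr (fun b => #|pairs_of b|)); last first.
  by move=> b /(subsetP CB) bB; rewrite card_pairs_of (sts_card sB bB).
rewrite -card_sigma_set; apply: (@leq_card_inj _ _ snd).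
  move=> [b [x y]] [b' [x' y']] /=; rewrite !inE /=.
  move=> /and4P[bC xb yx yb] /and4P[bC' xb' yx' yb'] [e e']; subst x' y'.
  congr (_, _); apply: (@sts_uniq B x y) => //; rewrite 1?eq_sym //; exact: (subsetP CB).
move=> [b [x y]]; rewrite !inE /= => /and4P[/CS /subsetP bS /bS -> _ /bS ->] //.
Qed.

(** For a moved [z], a fixed [y] is sent to the third point of their block. Were that point fixed,
    the block would be fixed and contain [p z], which differs from all its points. *)
Lemma sts_double_fixpts : p != 1%g -> #|fixpts p| + #|fixpts p| <= n.
Proof.
case/perm_neq1=> z pz; have zF y : y \in fixpts p -> z != y.
  by rewrite inE => /eqP py; apply: contraNneq pz => ->; rewrite py.
have [th hth] : exists th : 'I_n -> 'I_n, forall y, y \in fixpts p ->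
    [/\ [set z; y; th y] \in B, th y != z & th y != y].
  apply: (@fin_all_exists _ _ (fun y w => y \in fixpts p ->
    [/\ [set z; y; w] \in B, w != z & w != y])) => y.
  have [yF|_] := boolP (y \in fixpts p); last by exists y.
  by have [w hw] := sts_third sB (zF y yF); exists w.
rewrite -[X in _ <= X]card_ord; apply: (@double_card_fixpts _ _ th).
  move=> y y' yF yF' e; have [yB yz yy] := hth y yF; have [yB' yz' yy'] := hth y' yF'.
  have bb : [set z; y; th y] = [set z; y'; th y'].
    by apply: (@sts_uniq B z (th y)); rewrite ?e // -?e ?(eq_sym z) ?inE ?eqxx ?orbT.
  have : y \in [set z; y'; th y'] by rewrite -bb !inE eqxx orbT.
  rewrite !inE eq_sym (negbTE (zF y yF)) -e (eq_sym y (th y)) (negbTE yy) orbF /=.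
  by move/eqP.
move=> y yF; have [yB yz yy] := hth y yF; apply/negP; rewrite inE => /eqP pw.
have py : p y = y by apply/eqP; move: yF; rewrite inE.
have bb : p @: [set z; y; th y] = [set z; y; th y].
  apply: (@sts_uniq B y (th y)); rewrite ?sts_aut_mem // 1?eq_sym // ?inE ?eqxx ?orbT //.
    by rewrite -{1}py imset_f // !inE eqxx orbT.
  by rewrite -{1}pw imset_f // !inE eqxx orbT.
have : p z \in [set z; y; th y] by rewrite -bb imset_f // !inE eqxx.
have n1 : p z != y by rewrite -py (inj_eq perm_inj) zF.
have n2 : p z != th y by rewrite -pw (inj_eq perm_inj) eq_sym.
by rewrite !inE (negbTE pz) (negbTE n1) (negbTE n2).
Qed.

(** A fixed block either consists of fixed points, giving at most [(n / 2)^2 / 6] blocks, or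
    contains a moved [z] together with [p z] and is determined by [z]. *)
Lemma card_fixed_blocks : p != 1%g -> 24 * #|[set b in B | p @: b == b]| <= n * n + 24 * n.
Proof.
move=> p1; have ff := sts_double_fixpts p1.
pose C1 := [set b in B | b \subset fixpts p].
pose C2 := [set b in B | [exists z in b, (p z != z) && (p z \in b)]].
have c1 : 6 * #|C1| <= #|fixpts p| * #|fixpts p|.
  by apply: sts_card_pairs => [|b]; [apply/subsetP=> b|]; rewrite inE => /andP[].
have c2 : #|C2| <= n.
  pose z0 b : option 'I_n := [pick z in b | (p z != z) && (p z \in b)].
  rewrite -[X in _ <= X](card_ord n) -[X in _ <= X]card_ord.
  have inj : {in C2 &, injective z0}.
    move=> b b'; rewrite !inE => /andP[bB /exists_inP [z zb hz]] /andP[bB' _].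
    rewrite /z0; case: pickP => [u /and3P[ub pu pub]|/(_ z)]; last by rewrite /= zb hz.
    case: pickP => [u' /and3P[ub' pu' pub']|//] [e]; subst u'.
    by apply: (@sts_uniq B (p u) u).
  have [i0] : exists i : 'I_n, true by have [z _] := perm_neq1 p1; exists z.
  move=> _; rewrite card_ord.
  apply: (@leq_card_in _ _ (fun b => odflt i0 (z0 b))) => b b' bC bC'.
  have some c : c \in C2 -> z0 c = Some (odflt i0 (z0 c)).
    rewrite inE => /andP[_ /exists_inP [z zc hz]]; rewrite /z0.
    by case: pickP => [//|/(_ z)]; rewrite /= zc hz.
  by move=> e; apply: inj => //; rewrite some // [RHS]some // e.
have : #|[set b in B | p @: b == b]| <= #|C1| + #|C2|.
  apply: leq_trans (leq_card_setU _ _); apply: subset_leq_card; apply/subsetP=> b.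
  by rewrite !inE => /andP[-> /eqP/fixed_set_cases].
have := leq_mul ff ff; rewrite !mulnDl !mulnDr.
lia.
Qed.

End Fixed.

Lemma card_STSStar_le k : 0 < n -> 5 * (n * n) + 24 * n <= 48 * k ->
  #|STSStar n| <= n`! * n ^ k.
Proof.
move=> n0 hk.
pose S (p : {perm 'I_n}) :=
  if p != 1%g then [set B : {set {set 'I_n}} | sts B && sts_aut B p] else set0.
rewrite -card_Sn; apply: (@leq_card_cover _ _ _ S) => [B|p].
  by rewrite inE => /andP[sB /existsP [p /andP[a p1]]]; exists p; rewrite /S p1 inE sB.
rewrite /S; case: ifP => [p1|_]; rewrite ?cards0 //.
pose cov (q : 'I_n * 'I_n) := [set b : {set 'I_n} | [&& #|b| == 3, q.1 \in b & q.2 \in b]].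
apply: (@card_encode _ _ [set q | q.1 != q.2] cov (perm (@imset_perm_inj _ p))) => //.
- move=> [x y]; rewrite inE /= => xy; rewrite -[X in _ <= X]card_ord -cardsT.
  apply: leq_trans (leq_imset_card (fun z => [set x; y; z]) _).
  apply: subset_leq_card; apply/subsetP=> b; rewrite inE /= => /and3P[b3 xb yb].
  have [w [-> _ _]] := card3_third (eqP b3) xb yb xy.
  by apply/imsetP; exists w.
- move=> B [x y]; rewrite !inE /= => /andP[sB _] xy.
  have [b [bB xb yb]] := sts_exists sB xy; exists b => //.
  by rewrite inE (sts_card sB bB) xb yb.
- move=> B b; rewrite inE => /andP[sB _] bB.
  have : 1 < #|b| by rewrite (sts_card sB bB).
  case/card_gt1P=> x [y [xb yb xy]]; exists (x, y); first by rewrite inE.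
  by move=> c cB; rewrite inE /= => /and3P[_ xc yc]; apply: (@sts_uniq B x y).
- by move=> B b; rewrite inE permE => /andP[_ aB]; apply: sts_aut_mem.
move=> B; rewrite inE => /andP[sB aB]; rewrite /orbit_weight.
have := card_fixed_blocks sB aB p1.
have -> : [set b in B | p @: b == b] = [set b in B | perm (@imset_perm_inj _ p) b == b].
  by apply/setP=> b; rewrite !inE permE.
have := @sts_card_pairs B sB B setT (subxx _) (fun b _ => subsetT b).
rewrite cardsT card_ord; move: #|_| #|_| => u v; rewrite -mul2n; lia.
Qed.

End STS.

(** * Parallelisms with a prescribed automorphism *)

Section Par.
Variable n : nat.
Implicit Types (x y z c : 'I_n) (e : {set 'I_n}) (C : {set {set 'I_n}})
  (P : {set {set {set 'I_n}}}) (p : {perm 'I_n}).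

Lemma setU2_inj x y y' : x != y -> [set x; y] = [set x; y'] -> y = y'.
Proof.
move=> xy /setP/(_ y); rewrite !inE eqxx orbT eq_sym (negbTE xy) /=.
by move/esym/eqP.
Qed.

Lemma edges_pair x y : ([set x; y] \in edges n) = (x != y).
Proof. by rewrite inE cards2; case: (x != y). Qed.

Section Facts.
Variables (P : {set {set {set 'I_n}}}).
Hypothesis parP : parallelism P.

Lemma par_edge C e : C \in P -> e \in C -> #|e| = 2.
Proof.
by move=> CP eC; have /andP[_ /forall_inP/(_ C CP)/andP[_ /forall_inP/(_ e eC)/eqP]] := parP.
Qed.

Lemma par_pair C x y : C \in P -> [set x; y] \in C -> x != y.
Proof. by move=> CP /(par_edge CP)/eqP; rewrite -edges_pair inE. Qed.

Lemma par_exists e : e \in edges n -> exists2 C, C \in P & e \in C.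
Proof.
have /andP[/and3P[/eqP <- _ _] _] := parP.
by case/bigcupP=> C; exists C.
Qed.

Lemma par_uniq C C' e : C \in P -> C' \in P -> e \in C -> e \in C' -> C = C'.
Proof.
have /andP[/and3P[_ /trivIsetP tr _] _] := parP => CP CP' eC eC'.
apply/eqP; apply: contraT => /(tr _ _ CP CP')/pred0P/(_ e).
by rewrite /= eC eC'.
Qed.

Lemma par_match C x : C \in P -> exists y, [set x; y] \in C.
Proof.
move=> CP; have /andP[_ /forall_inP/(_ C CP)/andP[/and3P[/eqP cov _ _] _]] := parP.
have : x \in cover C by rewrite cov inE.
case/bigcupP=> e eC xe; have /eqP := par_edge CP eC.
case/cards2P=> u [v [uv eE]]; subst e.
by move: xe; rewrite !inE => /orP[] /eqP ->; [exists v | exists u; rewrite setUC].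
Qed.

Lemma par_meet C e e' x : C \in P -> e \in C -> e' \in C -> x \in e -> x \in e' -> e = e'.
Proof.
move=> CP eC eC' xe xe'.
have /andP[_ /forall_inP/(_ C CP)/andP[/and3P[_ /trivIsetP tr _] _]] := parP.
apply/eqP; apply: contraT => /(tr _ _ eC eC')/pred0P/(_ x).
by rewrite /= xe xe'.
Qed.

Lemma par_partner C x y y' : C \in P -> [set x; y] \in C -> [set x; y'] \in C -> y = y'.
Proof.
move=> CP yC yC'; apply: (setU2_inj (par_pair CP yC)).
by apply: (par_meet CP yC yC' (x := x)); rewrite !inE eqxx.
Qed.

Section Aut.
Variable p : {perm 'I_n}.
Hypothesis autP : par_aut P p.
Definition class_image C : {set {set 'I_n}} := [set [set p x | x in e] | e : {set 'I_n} in C].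

Lemma class_image_inj : injective class_image.
Proof. exact: imset_inj (@imset_perm_inj _ p). Qed.

Lemma par_aut_mem C : C \in P -> class_image C \in P.
Proof. by move=> CP; rewrite -(eqP autP); apply: imset_f. Qed.

Lemma class_image_mem C e : e \in C -> p @: e \in class_image C.
Proof. by move=> eC; apply/imsetP; exists e. Qed.

(** For a moved [z] and a fixed [y0], a fixed [y] is sent to the partner of [y0] in the class
    joining [z] to [y]. Were that partner fixed, the class would be fixed and join [y] to both [z]
    and [p z]. *)
Lemma par_double_fixpts : p != 1%g -> #|fixpts p| + #|fixpts p| <= n.
Proof.
case/perm_neq1=> z pz; have zF y : y \in fixpts p -> z != y.
  by rewrite inE => /eqP py; apply: contraNneq pz => ->; rewrite py.
have [->|/set0Pn [y0 y0F]] := eqVneq (fixpts p) set0; first by rewrite cards0.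
have [w hw] : exists w : 'I_n -> 'I_n, forall y, y \in fixpts p ->
    exists C, [/\ C \in P, [set z; y] \in C & [set y0; w y] \in C].
  apply: (@fin_all_exists _ _ (fun y w => y \in fixpts p ->
    exists C, [/\ C \in P, [set z; y] \in C & [set y0; w] \in C])) => y.
  have [yF|_] := boolP (y \in fixpts p); last by exists y.
  have [|C CP eC] := @par_exists [set z; y]; first by rewrite edges_pair zF.
  by have [w wC] := par_match y0 CP; exists w => _; exists C.
rewrite -[X in _ <= X]card_ord; apply: (@double_card_fixpts _ _ w).
  move=> y y' /hw [C [CP yC wC]] /hw [C' [CP' yC' wC']] e.
  rewrite -e in wC'; have CC := par_uniq CP CP' wC wC'; subst C'.
  exact: par_partner CP yC yC'.
move=> y yF; have [C [CP yC wC]] := hw y yF; apply/negP; rewrite inE => /eqP fw.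
have [/eqP fy /eqP fy0] : p y == y /\ p y0 == y0 by move: yF y0F; rewrite !inE.
have CC : class_image C = C.
  apply: (@par_uniq _ _ [set y0; w y]); rewrite ?par_aut_mem //.
  by have := class_image_mem wC; rewrite imsetU1 imset_set1 fw fy0.
have := class_image_mem yC; rewrite CC imsetU1 imset_set1 fy setUC => yC2.
rewrite setUC in yC; have := par_partner CP yC yC2 => e.
by rewrite -e eqxx in pz.
Qed.

End Aut.

Variable x0 : 'I_n.

(* The class of an edge is labelled by the partner of [x0] in it. *)
Definition labelled_edges (P : {set {set {set 'I_n}}}) : {set {set 'I_n} * 'I_n} :=
  [set t | [exists C in P, (t.1 \in C) && ([set x0; t.2] \in C)]].

Lemma labelled_edgesP e c : reflect (exists C, [/\ C \in P, e \in C & [set x0; c] \in C])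
  ((e, c) \in labelled_edges P).
Proof.
rewrite inE; apply: (iffP exists_inP) => [[C CP /andP[eC cC]]|[C [CP eC cC]]].
  by exists C.
by exists C; rewrite ?eC.
Qed.

Lemma labelled_edges_uniq e c c' :
  (e, c) \in labelled_edges P -> (e, c') \in labelled_edges P -> c = c'.
Proof.
move=> /labelled_edgesP [C [CP eC cC]] /labelled_edgesP [C' [CP' eC' cC']].
have CC := par_uniq CP CP' eC eC'; subst C'; exact: par_partner CP cC cC'.
Qed.

Lemma labelled_edgesK : P = [set [set e | (e, c) \in labelled_edges P] | c in [set~ x0]].
Proof.
have key C c : C \in P -> [set x0; c] \in C -> C = [set e | (e, c) \in labelled_edges P].
  move=> CP cC; apply/setP=> e; rewrite inE; apply/idP/labelled_edgesP => [eC|[C' [CP' eC' cC']]].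
    by exists C.
  by rewrite (par_uniq CP CP' cC cC').
apply/setP=> C; apply/idP/imsetP => [CP|[c c0 ->]].
  have [c cC] := par_match x0 CP; exists c; last exact: key.
  by rewrite !inE eq_sym; apply: par_pair CP cC.
have [|C' CP' cC'] := @par_exists [set x0; c].
  by rewrite edges_pair; move: c0; rewrite !inE eq_sym.
by rewrite -(key C').
Qed.

Lemma card_labelled_edges : 2 * #|labelled_edges P| <= n * n.
Proof.
apply: (@leq_trans (2 * #|edges n|)).
  rewrite leq_mul2l; apply: (@leq_card_inj _ _ fst) => [[e c] [e' c'] h h' /= ee|[e c]].
    by move: h h'; rewrite -ee => h h'; rewrite (labelled_edges_uniq h h').
  by case/labelled_edgesP=> C [CP eC _]; rewrite inE (par_edge CP eC).
have -> : #|edges n| = 'C(n, 2) by have := card_draws 'I_n 2; rewrite card_ord.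
by rewrite bin2 mul2n; have := odd_double_half (n * n.-1); nia.
Qed.

(** [p] permutes the classes and hence their labels. No class has label [x0]; fixing this value
    completes the map to a permutation. *)
Lemma label_perm_exists p : par_aut P p -> exists s : {perm 'I_n}, forall e c,
  (e, c) \in labelled_edges P -> (p @: e, s c) \in labelled_edges P.
Proof.
move=> autP.
have [s hs] : exists s : 'I_n -> 'I_n, forall c, (c = x0 -> s c = x0) /\
    forall C, C \in P -> [set x0; c] \in C -> [set x0; s c] \in class_image p C.
  apply: (@fin_all_exists _ _ (fun c s => (c = x0 -> s = x0) /\
    forall C, C \in P -> [set x0; c] \in C -> [set x0; s] \in class_image p C)) => c.
  have [->|c0] := eqVneq c x0.
    by exists x0; split=> // C CP /(par_pair CP); rewrite eqxx.
  have [|C CP cC] := @par_exists [set x0; c]; first by rewrite edges_pair eq_sym.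
  have [d dC] := par_match x0 (par_aut_mem autP CP); exists d; split=> [h|C' CP' cC'].
    by rewrite h eqxx in c0.
  by rewrite -(par_uniq CP CP' cC cC').
have inj : injective s.
  move=> c c' e; have [cx hc] := hs c; have [cx' hc'] := hs c'.
  have sx (d : 'I_n) : d != x0 -> s d != x0.
    move=> d0; have [|C CP dC] := @par_exists [set x0; d]; first by rewrite edges_pair eq_sym.
    have [_ hd] := hs d; have := hd C CP dC => /(par_pair (par_aut_mem autP CP)).
    by rewrite eq_sym.
  have [ce|c0] := eqVneq c x0; have [ce'|c0'] := eqVneq c' x0.
  - by rewrite ce ce'.
  - by have := sx _ c0'; rewrite -e (cx ce) eqxx.
  - by have := sx _ c0; rewrite e (cx' ce') eqxx.
  have [|C CP cC] := @par_exists [set x0; c]; first by rewrite edges_pair eq_sym.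
  have [|C' CP' cC'] := @par_exists [set x0; c']; first by rewrite edges_pair eq_sym.
  have h1 := hc _ CP cC; have h2 := hc' _ CP' cC'; rewrite -e in h2.
  have := par_uniq (par_aut_mem autP CP) (par_aut_mem autP CP') h1 h2.
  move/class_image_inj=> CC; subst C'; exact: par_partner CP cC cC'.
exists (perm inj) => e c /labelled_edgesP [C [CP eC cC]]; apply/labelled_edgesP.
exists (class_image p C); split; first exact: par_aut_mem.
  exact: class_image_mem.
by rewrite permE; have [_] := hs c; apply.
Qed.

(** An edge fixed by [p] joins two fixed points, giving at most [(n / 2)^2 / 2] edges, or consists
    of some [z] and [p z]. *)
Lemma card_fixed_edges (p s : {perm 'I_n}) : par_aut P p -> p != 1%g ->
  8 * #|[set t in labelled_edges P | (p @: t.1, s t.2) == t]| <= n * n + 8 * n.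
Proof.
move=> autP p1; have ff := par_double_fixpts autP p1.
pose E1 := [set e in edges n | e \subset fixpts p].
pose E2 := [set [set z; p z] | z : 'I_n].
have c1 : 2 * #|E1| <= #|fixpts p| * #|fixpts p|.
  have -> : #|E1| = 'C(#|fixpts p|, 2).
    rewrite -cards_draws; apply: eq_card => e; by rewrite !inE andbC.
  by rewrite bin2 mul2n; have := odd_double_half (#|fixpts p| * #|fixpts p|.-1); nia.
have c2 : #|E2| <= n by rewrite -[X in _ <= X](card_ord n); apply: leq_imset_card.
have : #|[set t in labelled_edges P | (p @: t.1, s t.2) == t]| <= #|E1| + #|E2|.
  apply: leq_trans (leq_card_setU _ _); apply: (@leq_card_inj _ _ fst).
    move=> [e c] [e' c'] /=; rewrite inE => /andP[h _]; rewrite inE => /andP[h' _] ee.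
    by move: h h'; rewrite -ee => h h'; rewrite (labelled_edges_uniq h h').
  move=> [e c]; rewrite inE => /andP[/labelled_edgesP [C [CP eC _]] /eqP [/fixed_set_cases h _]].
  have e2 : #|e| = 2 := par_edge CP eC.
  rewrite /= in_setU; case/orP: h => [eF|/exists_inP [z ze /andP[pz pze]]].
    by rewrite inE eF inE e2.
  apply/orP; right; apply/imsetP; exists z => //; apply/esym/eqP.
  rewrite eqEcard e2 cards2 eq_sym pz andbT; apply/subsetP=> u; rewrite !inE.
  by case/orP=> /eqP ->.
have := leq_mul ff ff; rewrite !mulnDl !mulnDr.
lia.
Qed.

End Facts.

(** The permutation of labels depends on the parallelism, so it is guessed along with [p]; hence the
    second [n!]. *)
Lemma card_ParStar_le k : 0 < n -> 5 * (n * n) + 8 * n <= 16 * k ->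
  #|ParStar n| <= n`! * n`! * n ^ k.
Proof.
move=> n0 hk; pose x0 := Ordinal n0.
pose S (ps : {perm 'I_n} * {perm 'I_n}) := if ps.1 != 1%g then
  [set P : {set {set {set 'I_n}}} | [&& parallelism P, par_aut P ps.1 &
    [forall t in labelled_edges x0 P, (ps.1 @: t.1, ps.2 t.2) \in labelled_edges x0 P]]]
  else set0.
have -> : n`! * n`! = #|{: {perm 'I_n} * {perm 'I_n}}| by rewrite card_prod card_Sn.
apply: (@leq_card_cover _ _ _ S) => [P|[p s]].
  rewrite inE => /andP[parP /existsP [p /andP[autP p1]]].
  have [s hs] := label_perm_exists parP x0 autP; exists (p, s); rewrite /S /= p1 inE parP autP.
  by apply/forall_inP=> -[e c]; apply: hs.
rewrite /S /=; case: ifP => [p1|_]; rewrite ?cards0 //.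
set A := [set P | _].
have inj : {in A &, injective (labelled_edges x0)}.
  move=> P P'; rewrite !inE => /and3P[parP _ _] /and3P[parP' _ _] e.
  by rewrite (labelled_edgesK parP x0) (labelled_edgesK parP' x0) e.
rewrite -(card_in_imset inj); set F := [set labelled_edges x0 _ | _ in _].
have FP (L : {set {set 'I_n} * 'I_n}) : L \in F -> exists P, [/\ L = labelled_edges x0 P,
    parallelism P, par_aut P p & forall e c, (e, c) \in L -> (p @: e, s c) \in L].
  case/imsetP=> P; rewrite inE => /and3P[parP aP /forall_inP h] ->; exists P; split=> // e c.
  exact: h.
pose g (t : {set 'I_n} * 'I_n) := (p @: t.1, s t.2).
have ginj : injective g.
  by move=> [e c] [e' c'] [/imset_perm_inj -> /perm_inj ->].
pose cov e := [set t : {set 'I_n} * 'I_n | t.1 == e].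
apply: (@card_encode _ _ (edges n) cov (perm ginj)) => //.
- move=> e _; rewrite -[X in _ <= X]card_ord.
  apply: (@leq_card_in _ _ snd) => -[u c] [u' c']; rewrite !inE /= => /eqP -> /eqP -> -> //.
- move=> L e /FP [P [-> parP _ _]] /(par_exists parP) [C CP eC].
  have [c cC] := par_match parP x0 CP; exists (e, c); last by rewrite inE.
  by apply/labelled_edgesP; exists C.
- move=> L [e c] /FP [P [-> parP _ _]] h; exists e.
    by case/labelled_edgesP: h => C [CP eC _]; rewrite inE (par_edge parP CP eC).
  move=> [e' c'] h'; rewrite inE /= => /eqP ee; move: h'; rewrite ee => h'.
  by rewrite (labelled_edges_uniq parP h h').
- by move=> L [e c] /FP [P [_ _ _ h]] eL; rewrite permE; apply: h.
move=> L /FP [P [-> parP aP _]]; rewrite /orbit_weight.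
have := card_fixed_edges parP x0 s aP p1.
have -> : [set t in labelled_edges x0 P | (p @: t.1, s t.2) == t] =
    [set t in labelled_edges x0 P | perm ginj t == t].
  by apply/setP=> t; rewrite !in_set permE.
have := card_labelled_edges parP x0; move: #|_| #|_| => u v; rewrite -mul2n; lia.
Qed.

End Par.

(** * Asymptotics *)

Lemma ratio_tends_to0 (star tot : nat -> nat) (adm : nat -> bool) (N : nat) :
  (forall n, N <= n -> adm n -> star n * n <= tot n) ->
  forall eps : rat, (0 < eps)%R -> exists N : nat, forall n, N <= n -> adm n ->
    ((star n)%:R / (tot n)%:R < eps)%R.
Proof.
move=> h eps e0; have inv0 : (0 <= eps^-1)%R by rewrite invr_ge0 ltW.
exists (maxn N (Num.bound eps^-1)) => n; rewrite geq_max => /andP[Nn bn] an.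
have ne : (1 < eps * n%:R)%R.
  rewrite mulrC -ltr_pdivrMr // mul1r.
  by apply: lt_le_trans (archi_boundP inv0) _; rewrite ler_nat.
(* Division by 0 gives 0, so an order without objects causes no trouble. *)
have [t0|t0] := posnP (tot n); first by rewrite t0 invr0 mulr0.
rewrite ltr_pdivrMr ?ltr0n //.
have [->|s0] := posnP (star n); first by rewrite mulr_gt0 ?ltr0n.
have : ((star n)%:R * n%:R <= (tot n)%:R :> rat)%R by rewrite -natrM ler_nat h.
rewrite -(ler_pM2l e0); apply: lt_le_trans.
by rewrite mulrCA ltr_pMr ?ltr0n.
Qed.

(** A gap [s] between the exponents gives [n ^ s >= 2 ^ (100 D s)], which absorbs [2 ^ (D * n^2)].
    The 1/100 lies well below the gaps of about 3/8, 3/16 and 1/16 of [n^2] for squares,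
    parallelisms and triple systems, leaving room for linear terms. *)
Lemma exp_growth D : exists N, forall n, N <= n -> forall star tot k e s,
  star <= n ^ k -> n ^ e <= 2 ^ (D * (n * n)) * tot -> k + s + 2 <= e -> n * n <= 100 * s ->
  star * n ^ 2 <= tot.
Proof.
exists (2 ^ (D * 100)).+1 => n Nn star tot k e s hs ht ke ns.
have p0 : 0 < 2 ^ (D * (n * n)) by rewrite expn_gt0.
rewrite -(leq_pmul2l p0); apply: leq_trans ht.
have n0 : 0 < n by apply: leq_ltn_trans Nn.
apply: leq_trans (leq_pexp2l n0 ke).
rewrite addnAC expnD mulnC leq_mul ?expnD //.
  by rewrite leq_mul2r hs orbT.
apply: (@leq_trans (2 ^ (D * (100 * s)))); first by rewrite leq_exp2l // leq_mul2l ns orbT.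
by rewrite mulnA expnM leq_exp2 // ltnW.
Qed.

Lemma fact_le_expnn n : n`! <= n ^ n.
Proof.
elim: n => // n IH; rewrite factS expnS leq_mul2l /=.
by apply: leq_trans IH _; apply: leq_exp2.
Qed.

Lemma latin_star_small : exists N, forall n, N <= n -> true ->
  #|LatinSquaresStar n| * n <= #|LatinSquares n|.
Proof.
have [N hN] := exp_growth 4; exists (maxn N 100) => n; rewrite geq_max => /andP[Nn n100] _.
have n0 : 0 < n by lia.
have nn : 100 * n <= n * n by rewrite leq_mul2r n100 orbT.
pose k := (5 * (n * n) + 4 * n) %/ 8 + 1.
apply: (@leq_trans (#|LatinSquaresStar n| * n ^ 2)); first by rewrite leq_mul2l -mulnn leq_pmull ?orbT.
apply: (hN n Nn _ _ (1 + n * 3 + k) (n * n) (n * n %/ 100 + 1)).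
- apply: leq_trans (@card_LatinSquaresStar_le n k n0 _) _; first by rewrite /k; lia.
  rewrite !expnD expn1 leq_mul2r; apply/orP; right; rewrite leq_mul //; first by lia.
  by rewrite expnM leq_exp2 // fact_le_expnn.
- have -> : #|LatinSquares n| = #|Lat 'I_n 'I_n 'I_n| by apply: eq_card => L; rewrite !inE.
  by apply: Lat_bound; rewrite card_ord.
- by rewrite /k; lia.
- by lia.
Qed.

Lemma par_star_small : exists N, forall n, N <= n -> ~~ odd n -> #|ParStar n| * n <= #|Par n|.
Proof.
have [N hN] := exp_growth 6; exists (maxn N 100) => n; rewrite geq_max => /andP[Nn n100] en.
have n0 : 0 < n by lia.
have nn : 100 * n <= n * n by rewrite leq_mul2r n100 orbT.
pose k := (5 * (n * n) + 8 * n) %/ 16 + 1.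
have [t nt] : exists t, n = t + t by exists n./2; rewrite addnn even_halfK.
have tt : n * n = 4 * (t * t) by rewrite nt; lia.
apply: (@leq_trans (#|ParStar n| * n ^ 2)); first by rewrite leq_mul2l -mulnn leq_pmull ?orbT.
(* The exponent drops by [n] to pay for the factor [n ^ n] in [card_Par_ge]. *)
apply: (hN n Nn _ _ (n + n + k) (2 * (t * t) - n) (n * n %/ 100 + 1)).
- apply: leq_trans (@card_ParStar_le n k n0 _) _; first by rewrite /k; lia.
  by rewrite !expnD leq_mul2r leq_mul ?orbT // fact_le_expnn.
- have s0 := Ordinal n0; have pn : 0 < n ^ n by rewrite expn_gt0 n0.
  rewrite -(leq_pmul2l pn) -expnD subnKC; last by lia.
  have := @card_unipotent_ge t 'I_n 'I_n s0; rewrite card_ord -nt => /(_ erefl erefl) h.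
  apply: leq_trans h _; have -> : 6 * (n * n) = 24 * (t * t) by lia.
  by rewrite [X in _ <= X]mulnCA leq_mul2l card_Par_ge orbT.
- by rewrite /k; lia.
- by lia.
Qed.

Lemma sts_star_small : exists N, forall n, N <= n -> sts_admissible n ->
  #|STSStar n| * n <= #|STS n|.
Proof.
have [N hN] := exp_growth 20; exists (maxn N 100) => n; rewrite geq_max => /andP[Nn n100] adm.
have n0 : 0 < n by lia.
have nn : 100 * n <= n * n by rewrite leq_mul2r n100 orbT.
pose k := (5 * (n * n) + 24 * n) %/ 48 + 1.
have hk : #|STSStar n| <= n ^ (n + k).
  apply: leq_trans (@card_STSStar_le n k n0 _) _; first by rewrite /k; lia.
  by rewrite expnD leq_mul2r fact_le_expnn orbT.
case/orP: adm => /eqP n6.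
- have [t nt] : exists t, n = 6 * t + 1 by exists (n %/ 6); lia.
  have tt : n * n = 36 * (t * t) + 12 * t + 1 by rewrite nt; lia.
  apply: (@leq_trans (#|STSStar n| * n ^ 2)); first by rewrite leq_mul2l -mulnn leq_pmull ?orbT.
  apply: (hN n Nn _ _ (n + k) (6 * (t * t)) (n * n %/ 100 + 1)) => //; try (rewrite /k; lia).
  have ct : #|'I_t| = t by rewrite card_ord.
  have t0 : 0 < t by lia.
  have h := card_half_idempotent_ge ct ct t0.
  have hS : #|symLat (@half_diag 'I_t 'I_t)| ^ 3 <= #|STS n|.
    by apply: card_STS_skolem; rewrite ct; lia.
  apply: (@leq_trans ((2 ^ 2 * (t + t)) ^ (6 * (t * t)))); first by apply: leq_exp2; lia.
  rewrite expnMn -expnM.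
  have -> : (t + t) ^ (6 * (t * t)) = ((t + t) ^ (2 * (t * t))) ^ 3.
    by rewrite -expnM; congr (_ ^ _); lia.
  apply: leq_trans (leq_mul (leqnn _) (leq_exp2 3 h)) _.
  rewrite expnMn mulnA -expnM -expnD leq_mul // leq_exp2l //; lia.
have [m nm] : exists m, n = m * 3 by exists (n %/ 3); lia.
have mm : n * n = 9 * (m * m) by rewrite nm; lia.
have om : odd m by lia.
(* The odd-order bound concerns the square of the number of idempotent squares, so the whole
   comparison is squared. *)
rewrite -leq_sqr expnMn.
apply: (hN n Nn _ _ ((n + k) * 2) (3 * (m * m)) (n * n %/ 100 + 1)) => //; try (rewrite /k; lia).
  by rewrite expnM leq_exp2.
have h := @card_idempotent_ge 'I_m; rewrite card_ord in h; have {}h := h om.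
have hS : #|symLat (@id 'I_m)| ^ 3 <= #|STS n| by apply: card_STS_bose; rewrite card_ord.
apply: (@leq_trans ((2 ^ 2 * m) ^ (3 * (m * m)))); first by apply: leq_exp2; lia.
rewrite expnMn -expnM.
have -> : m ^ (3 * (m * m)) = (m ^ (m * m)) ^ 3 by rewrite -expnM; congr (_ ^ _); lia.
apply: leq_trans (leq_mul (leqnn _) (leq_exp2 3 h)) _.
rewrite expnMn mulnA -expnM -expnD leq_mul //.
  rewrite leq_exp2l //; nia.
by rewrite mulnn -expnM mulnC expnM leq_exp2.
Qed.

Theorem mainTheorem1 :
  (forall eps : rat, (0 < eps)%R -> exists N : nat, forall n : nat, (N <= n)%N ->
     ((#|LatinSquaresStar n|%:R / #|LatinSquares n|%:R) < eps)%R) /\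
  (forall eps : rat, (0 < eps)%R -> exists N : nat, forall n : nat, (N <= n)%N ->
     sts_admissible n ->
     ((#|STSStar n|%:R / #|STS n|%:R) < eps)%R) /\
  (forall eps : rat, (0 < eps)%R -> exists N : nat, forall n : nat, (N <= n)%N ->
     ~~ odd n ->
     ((#|ParStar n|%:R / #|Par n|%:R) < eps)%R).
Proof.
split; [|split].
- have [N hN] := latin_star_small => eps e0.
  have [M hM] := @ratio_tends_to0 (fun n => #|LatinSquaresStar n|) _ (fun=> true) N hN eps e0.
  by exists M => n Mn; apply: hM.
- have [N hN] := sts_star_small.
  exact: (@ratio_tends_to0 (fun n => #|STSStar n|) _ sts_admissible N hN).
- have [N hN] := par_star_small.
  exact: (@ratio_tends_to0 (fun n => #|ParStar n|) _ (fun n => ~~ odd n) N hN).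
Qed.
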